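(* Let $n\ge 3$ and let $h:\mathbb{B}^n\to(-1,1)$ be a harmonic or hyperbolic harmonic function. Then the following sharp estimates hold: $$|\nabla h(0)|\le\begin{cases}\dfrac{n}{2}\,(1-|h(0)|^2) & \text{if } h \text{ is harmonic},\\[2mm] (n-1)\,(1-|h(0)|^2) & \text{if } h \text{ is hyperbolic harmonic}.\end{cases}$$ (Sharp means that the constants $\frac n2$ and $n-1$, respectively, cannot be replaced by smaller ones valid for all such $h$.) Furthermore, the inequality is strict for $n\ge 4$.
   Context: $\mathbb{B}^n$ is the open unit ball of $\mathbb{R}^n$ and $|\cdot|$ the Euclidean norm. A function $u\in C^2(\mathbb{B}^n,\mathbb{R})$ is hyperbolic harmonic if $\Delta_h u=0$ on $\mathbb{B}^n$, where $$\Delta_h u(x)=(1-|x|^2)^2\Delta u(x)+2(n-2)(1-|x|^2)\sum_{i=1}^n x_i\frac{\partial u}{\partial x_i}(x)$$ and $\Delta$ is the Euclidean Laplacian. *)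

(* Defs.v *)
From HB Require Import structures.
From mathcomp Require Import all_boot all_order all_algebra.
From mathcomp Require Import all_classical all_reals all_analysis.

Set Implicit Arguments.
Unset Strict Implicit.
Unset Printing Implicit Defensive.

Import Order.TTheory GRing.Theory Num.Theory.
Import numFieldNormedType.Exports.

Local Open Scope classical_set_scope.
Local Open Scope ring_scope.

(* The library norm on row vectors is the sup norm, hence [enorm]; both norms
   induce the same topology, so limits and continuity are those of R^n. *)
Definition enorm (R : realType) (n : nat) (x : 'rV[R]_n) : R :=
  Num.sqrt (\sum_(i < n) x 0 i ^+ 2).

Definition unit_ball (R : realType) (n : nat) : set 'rV[R]_n :=
  [set x | enorm x < 1].

Definition partial (R : realType) (n : nat) (i : 'I_n) (u : 'rV[R]_n -> R) :
    'rV[R]_n -> R :=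
  'D_(delta_mx 0 i) u.

Definition grad (R : realType) (n : nat) (u : 'rV[R]_n -> R) (x : 'rV[R]_n) :
    'rV[R]_n :=
  \row_(i < n) partial i u x.

Definition laplacian (R : realType) (n : nat) (u : 'rV[R]_n -> R)
    (x : 'rV[R]_n) : R :=
  \sum_(i < n) partial i (partial i u) x.

Definition hyp_laplacian (R : realType) (n : nat) (u : 'rV[R]_n -> R)
    (x : 'rV[R]_n) : R :=
  (1 - enorm x ^+ 2) ^+ 2 * laplacian u x
  + 2 * (n%:R - 2) * (1 - enorm x ^+ 2) * \sum_(i < n) x 0 i * partial i u x.

(* Class C^k on an open set U: the iterated partial derivatives of order at
   most k exist and are continuous at every point of U. A function on U is
   represented by a total function; since U is open, its values outside U are
   irrelevant here and in the operators above, evaluated at points of U. *)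
Fixpoint class_C (k : nat) (R : realType) (n : nat) (U : set 'rV[R]_n)
    (u : 'rV[R]_n -> R) : Prop :=
  (forall x, U x -> {for x, continuous u}) /\
  match k with
  | 0%N => True
  | k'.+1 => forall i : 'I_n,
      (forall x, U x -> derivable u x (delta_mx 0 i)) /\
      class_C k' U (partial i u)
  end.

Definition harmonic_on_ball (R : realType) (n : nat) (u : 'rV[R]_n -> R) : Prop :=
  class_C 2 (@unit_ball R n) u /\
  (forall x, unit_ball x -> laplacian u x = 0).

Definition hyp_harmonic_on_ball (R : realType) (n : nat) (u : 'rV[R]_n -> R) :
    Prop :=
  class_C 2 (@unit_ball R n) u /\
  (forall x, unit_ball x -> hyp_laplacian u x = 0).

Definition ball_to_pm1 (R : realType) (n : nat) (u : 'rV[R]_n -> R) : Prop :=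
  forall x, unit_ball x -> -1 < u x < 1.

(* Main.v *)
From HB Require Import structures.
Require Import Defs.
From mathcomp Require Import all_boot all_order all_algebra.
From mathcomp Require Import all_classical all_reals all_analysis.
From mathcomp Require Import ring lra zify.
Import Order.TTheory GRing.Theory Num.Theory.
Import numFieldNormedType.Exports.
Local Open Scope classical_set_scope.
Local Open Scope ring_scope.
Set Implicit Arguments.
Unset Strict Implicit.
Unset Printing Implicit Defensive.

(** Both equations are instances of
      (1 - eps |x|^2) Lap h + 2 eps (n - 2) x.grad h = 0,
    with eps = 0 for harmonic and eps = 1 for hyperbolic harmonic functions, and
    the estimate is proved for every eps in [0, 1], with m / 2 as constant,
    m = n + eps (n - 2).

    Let L be the rotation invariant mean over the unit sphere, e a unit vector,
    l(x) = <e, x>, and h a solution with values in (-1, 1).  Two functions of the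
    radius matter: A(r) = L(h(rx)) and B(r) = L(l(x) h(rx)).  The equation turns
    into ordinary differential equations for them.  The first one says that A is
    constant, A(r) = h(0) ([mean_value]).  The second one has a first integral:
    (1 - eps r^2) B'(r) + (n - 1) (1/r + eps r) B(r) is the mean over the sphere
    of radius r of the derivative of h along the vector field
    (1 + eps |x|^2) e - 2 eps <e, x> x (a translation or a Killing field of the
    hyperbolic metric), and it equals its value D_e h(0) at the centre
    ([killing_mean_const]).  A comparison argument then gives
    r D_e h(0) <= m B(r) ([first_moment_lower]).

    It remains to bound the first moment B(r) of a function with values in
    [-1, 1] whose mean is a = h(0).  For every s, B(r) - s a = L((l - s) h(rx)) is
    at most L|l - s|.  In dimension three l is uniformly distributed on [-1, 1]
    (Archimedes), so that L|l - s| = (1 + s^2)/2; in higher dimension it is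
    smaller, by at least an explicit amount ([mean_abs_linform]).  With s = -a this
    yields B(r) <= (1 - a^2)/2, hence D_e h(0) <= (m / 2)(1 - a^2), strictly when
    n >= 4.

    The only properties of L used here are that it is linear, positive,
    normalized, and that it annihilates the rotational derivatives
    x_i d_j f - x_j d_i f.  Such an L ([sphere_mean_exists]) is the limit, along an
    ultrafilter, of averages of f(x/|x|) over finer and finer cubic grids of R^n,
    weighted by a radial function w: the product of w with a rotational
    derivative is the divergence of a compactly supported field, and the sum of
    a partial derivative over a fine grid is almost a telescoping sum.

    Sharpness: if u is a bounded positive solution, the estimate with constant c,
    applied to -1 + u/B for an upper bound B of u, gives |grad u(0)| <= 2 c u(0)
    ([sharp_from_positive]).  A Poisson kernel whose pole approaches the sphere
    from outside has |grad u(0)| / u(0) -> n.  In the hyperbolic case, a bounded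
    solution which depends only on the distance to a geodesic hyperplane moving
    off to infinity has |grad u(0)| / u(0) -> 2 (n - 1). *)

(** * Continuously differentiable functions of several variables *)

(** The mean value theorem on the segment from 0 to [a], whatever the sign of
    [a]: it is the one of [0, 1] for the function u |-> g (u a). *)
Lemma MVT_theta {R : realType} (g dg : R -> R) (a : R) :
  (forall t : R, `|t| <= `|a| -> is_derive t 1 g (dg t)) ->
  exists2 t : R, `|t| <= `|a| & g a - g 0 = dg t * a.
Proof.
move=> H; pose G (u : R) := g (u * a).
have Ga (u : R) : 0 <= u <= 1 -> is_derive u 1 G (dg (u * a) * a).
  move=> /andP[u0 u1].
  have Hu : is_derive (u * a) 1 g (dg (u * a)).
    by apply: H; rewrite normrM ger0_norm // ler_piMl.
  have D : is_derive u 1 ( *%R ^~ a) (a : R).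
    have := is_deriveM (is_derive_id u (1 : R)) (is_derive_cst a u (1 : R)).
    by move=> D; apply: (is_derive_eq D); rewrite scaler0 add0r; exact: mulr1.
  exact: is_derive1_comp.
have [u||u uin E] := @MVT_segment R G (fun u => dg (u * a) * a) 0 1 ler01.
- by rewrite in_itv /= => /andP[h1 h2]; apply: Ga; rewrite !ltW.
- apply: (@continuous_in_subspaceT R R `[(0 : R), 1] G) => u /set_mem /=.
  rewrite in_itv /= => /Ga [D _]; apply: differentiable_continuous.
  exact/derivable1_diffP.
move: uin; rewrite in_itv /= => /andP[u0 u1].
exists (u * a); first by rewrite normrM ger0_norm // ler_piMl.
by move: E; rewrite /G mul1r mul0r subr0 mulr1.
Qed.

Section Calculus.
Context {R : realType} {n : nat}.
Implicit Types (x y v : 'rV[R]_n) (f g : 'rV[R]_n -> R).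

Notation e_ i := (delta_mx 0 i : 'rV[R]_n).

Lemma coord_le_norm x i : `|x 0 i| <= `|x|.
Proof.
rewrite [leRHS]/Num.norm /= mx_normrE; apply/bigmax_geP; right => /=.
by exists (0, i).
Qed.

Lemma norm_le_coord x (d : R) : 0 <= d -> (forall i, `|x 0 i| <= d) -> `|x| <= d.
Proof.
move=> d0 H; rewrite [leLHS]/Num.norm /= mx_normrE; apply/bigmax_leP; split => //.
by move=> [i j] _ /=; rewrite ord1.
Qed.

Lemma norm_e i : `|e_ i| <= 1.
Proof.
apply: norm_le_coord => // j; rewrite mxE eqxx /=.
by case: (j == i); rewrite ?normr1 ?normr0.
Qed.

(** Only [x] has to lie in [K]: continuity at the points of [K] is meant in the
    whole space, so that a compactness argument controls a neighbourhood of [K]. *)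
Lemma compact_unif (K : set 'rV[R]_n) f : compact K ->
  (forall x, K x -> {for x, continuous f}) ->
  forall e : R, 0 < e -> exists2 d : R, 0 < d &
    forall x y, K x -> `|x - y| < d -> `|f x - f y| < e.
Proof.
move=> /compact_near_coveringP cK cf e e0.
pose P (d : R) (x : 'rV[R]_n) := forall y, `|x - y| < d -> `|f x - f y| < e.
have e20 : 0 < e / 2 by lra.
have H : \forall d \near (0 : R)^'+, K `<=` P d.
  apply: (cK R (0 : R)^'+ P) => x Kx.
  have /cvgrPdist_lt /(_ (e / 2) e20) /nbhs_normP [d /= d0 Hd] := cf x Kx.
  have d20 : 0 < d / 2 by lra.
  have N : \forall z \near x, `|x - z| < d / 2.
    by apply/nbhs_normP; exists (d / 2).
  exists ([set z | `|x - z| < d / 2], [set t | t < d / 2]) => /=.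
    split; first exact: N.
    exact: nbhs_right_lt.
  move=> [z t] /= [xz td] y zy.
  have h1 : `|f x - f z| < e / 2 by apply: Hd => /=; lra.
  have h2 : `|f x - f y| < e / 2.
    apply: Hd => /=.
    have := ler_normD (x - z) (z - y); rewrite subrKA; lra.
  have := ler_normD (f z - f x) (f x - f y); rewrite subrKA (distrC (f z)
    (f x)); lra.
have [d [d0 Hd]] : exists d : R, 0 < d /\ K `<=` P d.
  near (0 : R)^'+ => d; exists d; split; near: d => //; exact: nbhs_right_gt.
by exists d => // x y Kx xy; exact: (Hd x Kx).
Unshelve. all: by end_near. Qed.

Lemma continuous_sum_ord m (F : 'I_m -> 'rV[R]_n -> R) x :
  (forall k, {for x, continuous (F k)}) ->
  {for x, continuous (fun y => \sum_k F k y)}.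
Proof.
elim: m F => [|m IH] F cF.
  have -> : (fun y => \sum_k F k y) = (fun=> 0).
    by apply/funext => y; rewrite big_ord0.
  exact: cst_continuous.
have -> : (fun y => \sum_k F k y) =
    (fun y => F ord0 y + \sum_k F (lift ord0 k) y).
  by apply/funext => y; rewrite big_ord_recl.
by apply: continuousD; [exact: cF|apply: IH => k; exact: cF].
Qed.

(** The partial derivatives are carried along explicitly, as the family [df], so
    that the calculus rules below compute them. *)
Definition C1_at f (df : 'I_n -> 'rV[R]_n -> R) x : Prop :=
  differentiable f x /\
  forall i, 'D_(e_ i) f x = df i x /\ {for x, continuous (df i)}.

Lemma row_sum_e v : v = \sum_(i < n) v 0 i *: e_ i.
Proof.
apply/rowP => j; rewrite summxE (bigD1 j) //= big1 => [|i ij].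
  by rewrite !mxE !eqxx mulr1 addr0.
by rewrite !mxE eqxx (eq_sym j) (negbTE ij) mulr0.
Qed.

Lemma C1_at_d f df x v : C1_at f df x -> 'd f x v = \sum_i v 0 i * df i x.
Proof.
move=> [fx H]; rewrite {1}(row_sum_e v) linear_sum; apply: eq_bigr => i _.
by rewrite linearZ /= -deriveE // (H i).1.
Qed.

Lemma C1_at_D f df x v : C1_at f df x -> 'D_v f x = \sum_i v 0 i * df i x.
Proof. by move=> H; rewrite deriveE ?(C1_at_d _ H)//; case: H. Qed.

Lemma C1_at_is_derive f df x v : C1_at f df x ->
  is_derive x v f (\sum_i v 0 i * df i x).
Proof.
move=> H; rewrite -(C1_at_D v H); apply: derivableP.
by apply: diff_derivable; case: H.
Qed.

Lemma C1_at_cont f df x : C1_at f df x -> {for x, continuous f}.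
Proof. by move=> [/differentiable_continuous]. Qed.

Lemma C1_at_ext f df dg x : (forall i y, df i y = dg i y) ->
  C1_at f df x -> C1_at f dg x.
Proof.
move=> E; have -> // : df = dg by apply/funext => i; apply/funext => y; exact: E.
Qed.

Lemma C1_at_cst (c : R) x : C1_at (fun=> c) (fun _ _ => 0) x.
Proof.
split=> [|i]; first exact: differentiable_cst.
by split; [rewrite derive_cst|exact: cst_continuous].
Qed.

Lemma C1_at_coord k x : C1_at (fun y => y 0 k) (fun i _ => (i == k)%:R) x.
Proof.
have H := @differentiable_coord R 1 n x 0 k.
split=> [//|i]; split; last exact: cst_continuous.
rewrite deriveE//.
have @f : {linear 'rV[R]_n -> R}.
  by exists (fun N : 'rV[R]_n => N 0 k); do 2![eexists]; do ?[constructor];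
     rewrite ?mxE// => ? *; rewrite ?mxE//; move=> ?; rewrite !mxE.
rewrite (_ : (fun _ => _) = f) // diff_lin; last exact: coord_continuous.
by rewrite /f /= mxE eqxx /= eq_sym.
Qed.

Lemma C1_at_add f df g dg x : C1_at f df x -> C1_at g dg x ->
  C1_at (fun y => f y + g y) (fun i y => df i y + dg i y) x.
Proof.
move=> [f1 f2] [g1 g2]; split=> [|i]; first exact: differentiableD.
have [<- cf] := f2 i; have [<- cg] := g2 i; split.
  by rewrite deriveD //; exact: diff_derivable.
exact: continuousD.
Qed.

Lemma C1_at_mul f df g dg x : C1_at f df x -> C1_at g dg x ->
  C1_at (fun y => f y * g y) (fun i y => df i y * g y + f y * dg i y) x.
Proof.
move=> F G; have [f1 f2] := F; have [g1 g2] := G; split=> [|i].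
  exact: differentiableM.
have [<- cf] := f2 i; have [<- cg] := g2 i; split.
  rewrite deriveM; try exact: diff_derivable.
  by rewrite addrC [_ *: _]mulrC.
apply: continuousD; apply: continuousM => //;
  [exact: C1_at_cont G|exact: C1_at_cont F].
Qed.

Lemma C1_at_comp (phi dphi : R -> R) f df x : C1_at f df x ->
  is_derive (f x) 1 phi (dphi (f x)) -> {for f x, continuous dphi} ->
  C1_at (fun y => phi (f y)) (fun i y => dphi (f y) * df i y) x.
Proof.
move=> F P Q; have [f1 f2] := F.
have dP : differentiable phi (f x) by apply/derivable1_diffP.
split=> [|i]; first exact: differentiable_comp.
have [fi cf] := f2 i; split.
  rewrite deriveE; last exact: differentiable_comp.
  have E1 : 'd f x (e_ i) = df i x by rewrite -deriveE.
  have E2 : 'd phi (f x) 1 = dphi (f x) by rewrite -deriveE // derive_val.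
  rewrite diff_comp //= E1 -{1}[df i x]mulr1 -[df i x * 1]/(df i x *: 1).
  rewrite linearZ /= E2; exact: mulrC.
apply: continuousM => //.
by apply: continuous_comp => //; exact: C1_at_cont F.
Qed.

Lemma C1_at_sum m (F : 'I_m -> 'rV[R]_n -> R) dF x :
  (forall k, C1_at (F k) (dF k) x) ->
  C1_at (fun y => \sum_k F k y) (fun i y => \sum_k dF k i y) x.
Proof.
elim: m F dF => [|m IH] F dF H.
  have := C1_at_cst 0 x; congr C1_at.
    by apply/funext => y; rewrite big_ord0.
  by apply/funext => i; apply/funext => y; rewrite big_ord0.
have := C1_at_add (H ord0) (IH (fun k => F (lift ord0 k)) (fun k => dF
  (lift ord0 k))
  (fun k => H (lift ord0 k))).
congr C1_at.
  by apply/funext => y; rewrite big_ord_recl.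
by apply/funext => i; apply/funext => y; rewrite big_ord_recl.
Qed.

(** The chain rule for an inner map given by its coordinates [g]. *)
Lemma C1_at_compv f df (g : 'I_n -> 'rV[R]_n -> R) dg x :
  C1_at f df (\row_k g k x) -> (forall k, C1_at (g k) (dg k) x) ->
  C1_at (fun y => f (\row_k g k y))
       (fun i y => \sum_k dg k i y * df k (\row_k g k y)) x.
Proof.
move=> F G; have [f1 f2] := F.
pose gv := fun y => \row_k g k y.
have gE : gv = \sum_(k < n) (fun y => g k y *: e_ k).
  apply/funext => y; rewrite /gv fct_sumE {1}[LHS]row_sum_e.
  by apply: eq_bigr => k _; rewrite mxE.
have gd : differentiable gv x.
  rewrite gE; apply: differentiable_sum => k; apply: differentiableZl.
  by case: (G k).
have gc : {for x, continuous gv} by exact: differentiable_continuous.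
split=> [|i]; first exact: (differentiable_comp gd).
split.
  rewrite deriveE; last exact: (differentiable_comp gd).
  rewrite (diff_comp gd) // -[LHS]/('d f (gv x) ('d gv x (e_ i))).
  rewrite (C1_at_d _ F); apply: eq_bigr => k _; congr (_ * _).
  have [gk gki] := G k; rewrite -(gki i).1 deriveE //.
  have : 'd (fun y => gv y 0 k) x (e_ i) = 'd gv x (e_ i) 0 k.
    have H := @differentiable_coord R 1 n (gv x) 0 k.
    rewrite (@diff_comp _ _ _ _ gv (fun N : 'rV[R]_n => N 0 k)) //=.
    rewrite (C1_at_d _ (C1_at_coord k (gv x))).
    rewrite (bigD1 k) //= eqxx mulr1 big1 ?addr0 // => j jk.
    by rewrite (negbTE jk) mulr0.
  move=> <-; have -> // : g k = (fun y => gv y 0 k).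
  by apply/funext => y; rewrite /gv mxE.
apply: (@continuous_sum_ord _ (fun k y => dg k i y * df k (gv y))) => k.
apply: continuousM; first by case: (G k) => _ /(_ i) [].
by apply: continuous_comp => //; case: (f2 k).
Qed.

Lemma is_derive_line f y v (t d : R) : is_derive (y + t *: v) v f d ->
  is_derive t 1 (fun s => f (y + s *: v)) d.
Proof.
have E : (fun h : R => h^-1 *: (((fun s => f (y + s *: v)) \o shift t) (h *: 1)
            - f (y + t *: v))) =
         (fun h : R => h^-1 *: ((f \o shift (y + t *: v)) (h *: v)
            - f (y + t *: v))).
  apply/funext => h /=; congr (_ *: (f _ - _)).
  by rewrite [_%:A]mulr1 scalerDl addrCA.
by move=> [H1 H2]; split; rewrite ?/derivable ?/derive E.
Qed.

Lemma line_MVT f (D : 'rV[R]_n -> R) y v (a : R) :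
  (forall t, `|t| <= `|a| -> is_derive (y + t *: v) v f (D (y + t *: v))) ->
  exists2 t, `|t| <= `|a| & f (y + a *: v) - f y = D (y + t *: v) * a.
Proof.
move=> H.
have [t ta|t ta E] := @MVT_theta R (fun s => f (y + s *: v))
    (fun s => D (y + s *: v)) a.
  by apply: is_derive_line; exact: H.
by exists t => //; rewrite -E scale0r addr0.
Qed.

(** Moving from [x] to [x + v] one coordinate at a time and applying the mean
    value theorem to each step compares the increment with the partial
    derivatives at points close to [x]. *)
Lemma partials_increment f (df : 'I_n -> 'rV[R]_n -> R) x :
  (\forall y \near x, forall i, is_derive y (e_ i) f (df i y)) ->
  (forall i, {for x, continuous (df i)}) ->
  forall e : R, 0 < e -> exists2 d : R, 0 < d & forall v, `|v| < d ->
   `|f (x + v) - f x - \sum_i v 0 i * df i x| <= e * `|v|.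
Proof.
move=> Hd Hc e e0.
have e1 : 0 < e / (n%:R + 1) by rewrite divr_gt0 // ltr_wpDl.
have /nbhs_normP [d /= d0 Hd'] : \forall y \near x, forall i,
    is_derive y (e_ i) f (df i y) /\ `|df i x - df i y| < e / (n%:R + 1).
  have : \forall y \near x, forall i, `|df i x - df i y| < e / (n%:R + 1).
    apply: (@filter_forall _ _ (fun i y => `|df i x - df i y| < e / (n%:R +
      1)) (nbhs x)) => i.
    by have /cvgrPdist_lt /(_ _ e1) := Hc i.
  by apply: filterS2 Hd => y h1 h2 i; split.
exists d => // v vd.
pose T k : 'rV[R]_n := \row_i (if (i < k)%N then v 0 i else 0).
have TS (k : 'I_n) : T k.+1 = T k + v 0 k *: e_ k.
  apply/rowP => i; rewrite !mxE eqxx /= ltnS.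
  case: (ltngtP i k) => ik.
  - by rewrite (_ : i == k = false) ?mulr0 ?addr0 //; apply/eqP => E;
    rewrite E ltnn in ik.
  - by rewrite (_ : i == k = false) ?mulr0 ?addr0 //; apply/eqP => E;
    rewrite E ltnn in ik.
  - by rewrite (val_inj ik : i = k) eqxx mulr1 add0r.
have step (k : 'I_n) : `|f (x + T k.+1) - f (x + T k) - v 0 k * df k x|
    <= e / (n%:R + 1) * `|v|.
  have near_x (t : R) : `|t| <= `|v 0 k| -> `|x - (x + T k + t *: e_ k)| < d.
    move=> tv; rewrite -addrA opprD addNKr normrN.
    apply: le_lt_trans vd; apply: norm_le_coord => // i; rewrite !mxE eqxx /=.
    case: (ltngtP i k) => ik.
    - rewrite (_ : i == k = false) ?mulr0 ?addr0 ?coord_le_norm //.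
      by apply/eqP => E; rewrite E ltnn in ik.
    - rewrite (_ : i == k = false) ?mulr0 ?addr0 ?normr0 //.
      by apply/eqP => E; rewrite E ltnn in ik.
    - rewrite (val_inj ik : i = k) eqxx mulr1 add0r.
      exact: (le_trans tv (coord_le_norm _ _)).
  have [t tv] := @line_MVT f (df k) (x + T k) (e_ k) (v 0 k)
    (fun t tv => (Hd' _ (near_x t tv) k).1).
  rewrite -addrA -TS => ->; rewrite [v 0 k * _]mulrC -mulrBl normrM.
  apply: ler_pM => //; last exact: coord_le_norm.
  rewrite distrC; exact: ltW (Hd' _ (near_x t tv) k).2.
have T0 : T 0%N = 0 by apply/rowP => i; rewrite !mxE.
have Tn : T n = v by apply/rowP => i; rewrite !mxE ltn_ord.
have -> : f (x + v) - f x - \sum_i v 0 i * df i x =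
  \sum_(k < n) (f (x + T k.+1) - f (x + T k) - v 0 k * df k x).
  rewrite sumrB; congr (_ - _).
  rewrite -(big_mkord xpredT (fun k => f (x + T k.+1) - f (x + T k))).
  by rewrite (telescope_sumr (fun k => f (x + T k))) // T0 Tn addr0.
apply: le_trans (ler_norm_sum _ _ _) _.
apply: le_trans (ler_sum _ (fun k _ => step k)) _.
rewrite sumr_const card_ord -[X in X <= _]mulr_natr (mulrAC (e / _)).
apply: ler_wpM2r => //; rewrite -mulrA ler_piMr ?(ltW e0) // mulrC.
by rewrite ler_pdivrMr ?ltr_wpDl // mul1r lerDl.
Unshelve. all: by end_near. Qed.

Lemma partials_C1_at f (df : 'I_n -> 'rV[R]_n -> R) x :
  (\forall y \near x, forall i, is_derive y (e_ i) f (df i y)) ->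
  (forall i, {for x, continuous (df i)}) -> C1_at f df x.
Proof.
move=> Hd Hc; split=> [|i]; last first.
  by split => //; have [_ ->] := nbhs_singleton Hd i.
have lin : linear (fun v => \sum_i v 0 i * df i x : R).
  move=> a u v; rewrite scaler_sumr -big_split; apply: eq_bigr => i _ /=.
  by rewrite !mxE mulrDl -mulrA.
pose LM := GRing.isLinear.Build _ _ _ _ _ lin.
pose L : {linear 'rV[R]_n -> R} := HB.pack (fun v => \sum_i v 0 i * df i x : R) LM.
have Lc : continuous L.
  move=> y; apply: (@continuous_sum_ord _ (fun i v => v 0 i * df i x)) => i.
  by apply: continuousM; [exact: coord_continuous|exact: cst_continuous].
have LE : f \o shift x = cst (f x) + (L : 'rV[R]_n -> R) +o_ (0 : 'rV[R]_n) id.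
  apply/eqaddoP => _/posnumP[e]; rewrite !near_simpl.
  have [d d0 H] := partials_increment Hd Hc [gt0 of e%:num].
  apply/nbhs_normP; exists d => // v /=; rewrite sub0r normrN => vd.
  apply: le_trans (H v vd); rewrite le_eqVlt; apply/orP; left; apply/eqP.
  by congr (`|_|); rewrite !fctE /= (addrC v) opprD addrA.
by apply/diff_locallyP; rewrite (diff_unique Lc LE).
Qed.

End Calculus.

(** * Gluing functions of one variable *)
Section Glue.
Context {R : realType}.
Implicit Types (s t : R).

Lemma cvg_if (T : Type) (F : set_system T) (FF : Filter F) (P : T -> bool)
    (f g : T -> R) (l : R) : f x @[x --> F] --> l -> g x @[x --> F] --> l ->
  (if P x then f x else g x) @[x --> F] --> l.
Proof.
move=> /cvgrPdist_lt fl /cvgrPdist_lt gl; apply/cvgrPdist_lt => e e0.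
by apply: filterS2 (fl e e0) (gl e e0) => x; case: (P x).
Qed.

Lemma continuous_glue (g1 g2 : R -> R) s : g1 s = g2 s ->
  (forall t, t <= s -> {for t, continuous g1}) ->
  (forall t, s <= t -> {for t, continuous g2}) ->
  continuous (fun t => if t <= s then g1 t else g2 t).
Proof.
move=> E c1 c2 t; rewrite /continuous_at.
have [ts|st|->] := ltgtP t s.
- have H : g1 x @[x --> t] --> g1 t := c1 t (ltW ts).
  apply: cvg_trans H.
  apply: near_eq_cvg; near=> u; suff -> : u <= s by [].
  by apply: ltW; near: u; exact: lt_nbhsl.
- have H : g2 x @[x --> t] --> g2 t := c2 t (ltW st).
  apply: cvg_trans H.
  apply: near_eq_cvg; near=> u; suff -> : u <= s = false by [].
  by apply/negbTE; rewrite -ltNge; near: u; exact: lt_nbhsr.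
- apply: cvg_if; first exact: c1.
  by rewrite E; exact: c2.
Unshelve. all: by end_near. Qed.

Lemma is_derive_glue (g1 g2 d1 d2 : R -> R) s : g1 s = g2 s -> d1 s = d2 s ->
  (forall t, t <= s -> is_derive t 1 g1 (d1 t)) ->
  (forall t, s <= t -> is_derive t 1 g2 (d2 t)) ->
  forall t, is_derive t 1 (fun t => if t <= s then g1 t else g2 t)
    (if t <= s then d1 t else d2 t).
Proof.
move=> E Ed D1 D2 t.
have [ts|st|ts] := ltgtP t s.
- apply: near_eq_is_derive (D1 t (ltW ts)).
  near=> u; suff -> : u <= s by [].
  by apply: ltW; near: u; exact: lt_nbhsl.
- apply: near_eq_is_derive (D2 t (ltW st)).
  near=> u; suff -> : u <= s = false by [].
  by apply/negbTE; rewrite -ltNge; near: u; exact: lt_nbhsr.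
rewrite ts.
have [c1 e1] := D1 s (lexx _); have [c2 e2] := D2 s (lexx _).
set g := fun t => _.
have H : h^-1 *: ((g \o shift s) (h *: 1) - g s) @[h --> 0^'] --> d1 s.
  have -> : (fun h : R => h^-1 *: ((g \o shift s) (h *: 1) - g s)) =
    (fun h => if h + s <= s then h^-1 *: ((g1 \o shift s) (h *: 1) - g1 s)
              else h^-1 *: ((g2 \o shift s) (h *: 1) - g2 s)).
    apply/funext => h; rewrite /g /= lexx [_%:A]mulr1.
    by case: (h + s <= s) => //; rewrite E.
  apply: cvg_if; first by rewrite -e1.
  by rewrite Ed -e2.
by split; [apply/cvg_ex; exists (d1 s)|apply: cvg_lim].
Unshelve. all: by end_near. Qed.

(** The square of the positive part: the simplest C^1 cut-off. *)
Definition pos_part_sq t := if t <= 0 then 0 else t ^+ 2.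
Definition dpos_part_sq t : R := if t <= 0 then 0 else 2 * t.

Lemma pos_part_sq_derive t : is_derive t 1 pos_part_sq (dpos_part_sq t).
Proof.
refine (@is_derive_glue (fun=> 0) (fun u => u ^+ 2) (fun=> 0)
  (fun u => 2 * u) 0 _ _ _ _ t).
- by rewrite expr0n.
- by rewrite mulr0.
- move=> u _; have := exp_derive1 2 u; rewrite expr1 => E; apply: DeriveDef.
    exact: exprn_derivable.
  by rewrite -derive1E E.
Qed.

Lemma dpos_part_sq_cont : continuous dpos_part_sq.
Proof.
apply: (@continuous_glue (fun=> 0) (fun u => 2 * u) 0).
- by rewrite mulr0.
- by move=> t _; exact: cst_continuous.
- by move=> t _; apply: continuousM; [exact: cst_continuous|exact: cvg_id].
Qed.

Lemma pos_part_sq_ge0 t : 0 <= pos_part_sq t.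
Proof. by rewrite /pos_part_sq; case: ifP => // _; rewrite sqr_ge0. Qed.

Lemma pos_part_sq_le0 t : t <= 0 -> pos_part_sq t = 0.
Proof. by rewrite /pos_part_sq => ->. Qed.

Lemma dpos_part_sq_le0 t : t <= 0 -> dpos_part_sq t = 0.
Proof. by rewrite /dpos_part_sq => ->. Qed.

Lemma pos_part_sq_ge (t a : R) : 0 < a -> a <= t -> a ^+ 2 <= pos_part_sq t.
Proof.
move=> a0 at_; have t0 := lt_le_trans a0 at_.
by rewrite /pos_part_sq [t <= 0]leNgt t0 /= ler_pXn2r // nnegrE; lra.
Qed.

End Glue.

(** * Radial functions and the projection to the sphere *)
Section Radial.
Context {R : realType} {n : nat}.
Implicit Types (x y : 'rV[R]_n) (f : 'rV[R]_n -> R).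
Notation e_ i := (delta_mx 0 i : 'rV[R]_n).

Lemma C1_at_near f df (g : 'rV[R]_n -> R) dg x :
  (\forall y \near x, f y = g y /\ forall i, df i y = dg i y) ->
  C1_at f df x -> C1_at g dg x.
Proof.
move=> H F; have [f1 f2] := F.
have He : \forall y \near x, f y = g y by apply: filterS H => y [].
have ed i : 'D_(e_ i) f x = 'D_(e_ i) g x by exact: near_eq_derive.
have gdiff : differentiable g x.
  have [f3 f4] := (diff_locallyP x f).1 f1.
  suff : g \o shift x = cst (g x) + 'd f x +o_ (0 : 'rV[R]_n) id.
    by move=> E; apply/diff_locallyP; rewrite (diff_unique f3 E).
  rewrite -(nbhs_singleton He).
  apply/eqaddoP => _/posnumP[e]; rewrite !near_simpl.
  have := f4 => /eqaddoP /(_ e%:num [gt0 of e%:num]); rewrite !near_simpl.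
  have H0 : \forall h \near (0 : 'rV[R]_n), f (h + x) = g (h + x).
    have /nbhs_normP [d /= d0 Hd] := He.
    apply/nbhs_normP; exists d => // h /=; rewrite sub0r normrN => hd.
    by apply: Hd; rewrite /= opprD addrCA subrr addr0 normrN.
  by apply: filterS2 H0 => h /= E; rewrite !fctE /= E.
split=> // i; split.
  by rewrite -ed (f2 i).1 (nbhs_singleton H).2.
have Hi : \forall y \near x, df i y = dg i y by apply: filterS H => y [].
have c : df i y @[y --> x] --> df i x := (f2 i).2.
rewrite (nbhs_singleton Hi) in c; apply: cvg_trans c.
exact: (@near_eq_cvg _ _ (nbhs x) _ (df i) (dg i) Hi).
Unshelve. all: by end_near. Qed.

Definition sqnorm x : R := \sum_i x 0 i ^+ 2.

Lemma sqnorm_ge0 x : 0 <= sqnorm x.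
Proof. by apply: sumr_ge0 => i _; rewrite sqr_ge0. Qed.

Lemma enormE x : enorm x = Num.sqrt (sqnorm x). Proof. by []. Qed.

Lemma enorm_sq x : enorm x ^+ 2 = sqnorm x.
Proof. by rewrite enormE sqr_sqrtr // sqnorm_ge0. Qed.

Lemma sqnorm_coord x i : x 0 i ^+ 2 <= sqnorm x.
Proof.
by rewrite /sqnorm (bigD1 i) //= lerDl; apply: sumr_ge0 => j _; rewrite sqr_ge0.
Qed.

Lemma coord_le_enorm x i : `|x 0 i| <= enorm x.
Proof. by rewrite enormE -sqrtr_sqr ler_wsqrtr // sqnorm_coord. Qed.

Lemma norm_le_enorm x : `|x| <= enorm x.
Proof.
by apply: norm_le_coord; [exact: sqrtr_ge0|move=> i; exact: coord_le_enorm].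
Qed.

Lemma sqnormZ (c : R) x : sqnorm (c *: x) = c ^+ 2 * sqnorm x.
Proof. by rewrite mulr_sumr; apply: eq_bigr => i _; rewrite mxE exprMn. Qed.

Lemma enormZ (c : R) x : enorm (c *: x) = `|c| * enorm x.
Proof. by rewrite !enormE sqnormZ sqrtrM ?sqr_ge0 // sqrtr_sqr. Qed.

Lemma C1_at_sqnorm x : C1_at sqnorm (fun i y => 2 * y 0 i) x.
Proof.
have := @C1_at_sum R n n (fun k y => y 0 k * y 0 k)
  (fun k i y => (i == k)%:R * y 0 k + y 0 k * (i == k)%:R) x
  (fun k => C1_at_mul (C1_at_coord k x) (C1_at_coord k x)).
have -> : (fun y : 'rV[R]_n => \sum_(k < n) y 0 k * y 0 k) = sqnorm.
  by apply/funext => y; apply: eq_bigr => k _; rewrite expr2.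
apply: C1_at_ext => i y; rewrite (bigD1 i) //= big1 ?eqxx => [|k ki].
  by rewrite mul1r mulr1 addr0 mulr2n mulrDl mul1r.
by rewrite eq_sym (negbTE ki) mul0r mulr0 addr0.
Qed.

Lemma sqnorm_cont : continuous sqnorm.
Proof. by move=> x; exact: C1_at_cont (C1_at_sqnorm x). Qed.

Lemma enorm_cont : continuous (@enorm R n).
Proof.
by move=> x; apply: (continuous_comp (sqnorm_cont (x := x)));
  exact: sqrt_continuous.
Qed.

Definition inv_enorm x : R := (enorm x)^-1.

Lemma inv_sqrt_derive (t : R) : 0 < t ->
  is_derive t 1 (fun u => (Num.sqrt u)^-1) (- (1/2) * (Num.sqrt t)^-1 ^+ 3).
Proof.
move=> t0; have s0 : Num.sqrt t != 0 by rewrite gt_eqF // sqrtr_gt0.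
have H := is_deriveV s0 (is_derive1_sqrt t0).
apply: (is_derive_eq H); change (- Num.sqrt t ^- 2 * (2 * Num.sqrt t)^-1 = -
  (1/2) * (Num.sqrt t)^-1 ^+ 3).
by field; rewrite s0.
Qed.

Lemma inv_sqrt_cont (t : R) : 0 < t ->
  {for t, continuous (fun u : R => (Num.sqrt u)^-1)}.
Proof.
move=> /inv_sqrt_derive [D _].
by apply: differentiable_continuous; apply/derivable1_diffP.
Qed.

Lemma C1_at_inv_enorm x : 0 < sqnorm x ->
  C1_at inv_enorm (fun i y => - y 0 i * inv_enorm y ^+ 3) x.
Proof.
move=> x0.
have := C1_at_comp (C1_at_sqnorm x) (inv_sqrt_derive x0)
  (dphi := fun t => - (1/2) * (Num.sqrt t)^-1 ^+ 3).
move=> H; apply: C1_at_ext (H _) => [i y|].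
  by rewrite /inv_enorm enormE; set s := (Num.sqrt _)^-1; field.
apply: continuousM; first exact: cst_continuous.
exact: (continuous_comp (inv_sqrt_cont x0) (@exprn_continuous R 3 _)).
Qed.

Definition radial_proj x : 'rV[R]_n := \row_k (x 0 k * inv_enorm x).

Lemma radial_projE x : radial_proj x = inv_enorm x *: x.
Proof. by apply/rowP => i; rewrite !mxE mulrC. Qed.

Lemma radial_proj_sphere x : 0 < sqnorm x -> enorm (radial_proj x) = 1.
Proof.
move=> x0; have e0 : 0 < enorm x by rewrite enormE sqrtr_gt0.
by rewrite radial_projE enormZ ger0_norm ?invr_ge0 ?(ltW e0) // mulVf // gt_eqF.
Qed.

Lemma C1_at_comp_radial_proj f df x : 0 < sqnorm x -> C1_at f df (radial_proj x) ->
  C1_at (fun y => f (radial_proj y))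
    (fun i y => inv_enorm y * df i (radial_proj y)
       - y 0 i * inv_enorm y ^+ 3 * \sum_k y 0 k * df k (radial_proj y)) x.
Proof.
move=> x0 F.
have := C1_at_compv F (fun k => C1_at_mul (C1_at_coord k x) (C1_at_inv_enorm x0)).
apply: C1_at_ext => i y.
under eq_bigr do rewrite mulrDl.
rewrite big_split /=; congr (_ + _).
  rewrite (bigD1 i) //= big1 ?eqxx ?mul1r ?addr0 // => k ki.
  by rewrite eq_sym (negbTE ki) !mul0r.
by rewrite -mulNr mulr_sumr; apply: eq_bigr => k _; rewrite -/(radial_proj y); ring.
Qed.

End Radial.

(** * Rotational derivatives as divergences *)
Section Weight.
Context {R : realType} {n : nat}.
Hypothesis n2 : (2 <= n)%N.
Implicit Types (x y : 'rV[R]_n) (f : 'rV[R]_n -> R).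
Notation e_ i := (delta_mx 0 i : 'rV[R]_n).

(** The weight is radial, vanishes outside of the unit ball, and vanishes near
    the origin, where x/|x| is singular.  The inner radius is chosen so that the
    cube [1/(2n), 1/n]^n lies in the region where the weight is positive. *)
Definition shell : R := (8 * n%:R)^-1.
Definition weight x : R := pos_part_sq (1 - sqnorm x) * pos_part_sq
  (sqnorm x - shell).
(** The gradient of [weight] at [x] is [dweight x *: x]. *)
Definition dweight (x : 'rV[R]_n) : R :=
  2 * (pos_part_sq (1 - sqnorm x) * dpos_part_sq (sqnorm x - shell)
       - dpos_part_sq (1 - sqnorm x) * pos_part_sq (sqnorm x - shell)).

Lemma dim_gt0 : 0 < n%:R :> R.
Proof. by rewrite ltr0n; case: n n2. Qed.

Lemma shell_gt0 : 0 < shell.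
Proof. by rewrite invr_gt0 mulr_gt0 // dim_gt0. Qed.

Lemma C1_at_weight x : C1_at weight (fun i y => y 0 i * dweight y) x.
Proof.
have A : C1_at (fun y => 1 - sqnorm y) (fun i y => - (2 * y 0 i)) x.
  have := C1_at_add (C1_at_cst 1 x) (C1_at_mul (C1_at_cst (-1) x) (C1_at_sqnorm x)).
  have -> : (fun y : 'rV[R]_n => 1 + -1 * sqnorm y) = (fun y => 1 - sqnorm y).
    by apply/funext => y; rewrite mulN1r.
  by apply: C1_at_ext => i y; ring.
have B : C1_at (fun y => sqnorm y - shell) (fun i y => 2 * y 0 i) x.
  have := C1_at_add (C1_at_sqnorm x) (C1_at_cst (- shell) x).
  by apply: C1_at_ext => i y; ring.
have := C1_at_mul (C1_at_comp A (pos_part_sq_derive _) (dpos_part_sq_cont (x := _)))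
   (C1_at_comp B (pos_part_sq_derive _) (dpos_part_sq_cont (x := _))).
by apply: C1_at_ext => i y; rewrite /dweight; ring.
Qed.

Lemma weight_ge0 x : 0 <= weight x.
Proof. by rewrite mulr_ge0 // pos_part_sq_ge0. Qed.

Lemma weight_out x : 1 <= sqnorm x -> weight x = 0.
Proof. by move=> h; rewrite /weight pos_part_sq_le0 ?mul0r // subr_le0. Qed.

Lemma weight_in x : sqnorm x <= shell -> weight x = 0 /\ dweight x = 0.
Proof.
move=> h; rewrite /weight /dweight (@pos_part_sq_le0 _ (sqnorm x - shell))
  ?subr_le0 //.
by rewrite dpos_part_sq_le0 ?subr_le0 // !mulr0 subrr mulr0.
Qed.

Lemma weight_neq0 x : weight x != 0 -> 0 < sqnorm x.
Proof.
rewrite lt_def sqnorm_ge0 andbT; apply: contraNneq => h.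
by rewrite (weight_in _).1 // h ltW // shell_gt0.
Qed.

Section Field.
Variables (f : 'rV[R]_n -> R) (df : 'I_n -> 'rV[R]_n -> R).
Hypothesis F : forall x, enorm x = 1 -> C1_at f df x.

(** The degree zero extension of [f], cut off by the weight, and its partial
    derivatives. *)
Let wf x := weight x * f (radial_proj x).
Let dwf i y := y 0 i * dweight y * f (radial_proj y) + weight y *
   (inv_enorm y * df i (radial_proj y)
       - y 0 i * inv_enorm y ^+ 3 * \sum_k y 0 k * df k (radial_proj y)).

(** Away from the origin this is the chain rule; near the origin the weight
    vanishes identically. *)
Lemma C1_at_wf x : C1_at wf dwf x.
Proof.
case: (ltP 0 (sqnorm x)) => x0.
  exact: (C1_at_mul (C1_at_weight x) (C1_at_comp_radial_proj x0 (F
    (radial_proj_sphere x0)))).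
apply: C1_at_near (C1_at_cst 0 x).
have : \forall y \near x, sqnorm y < shell.
  have c : sqnorm y @[y --> x] --> sqnorm x := @sqnorm_cont R n x.
  have h : sqnorm x < shell by rewrite (le_lt_trans x0) // shell_gt0.
  exact: (c _ (lt_nbhsl h)).
apply: filterS => y /ltW /weight_in [h1 h2].
by split=> [|i]; rewrite /wf /dwf h1 ?h2 ?mulr0 !mul0r ?addr0.
Qed.

(** The divergence of the field x_i w f(x/|x|) e_j - x_j w f(x/|x|) e_i: rotations
    do not see the radial factors. *)
Lemma rot_field i j x :
  ((j == i)%:R * wf x + x 0 i * dwf j x) - ((i == j)%:R * wf x + x 0 j * dwf i x)
  = weight x * (radial_proj x 0 i * df j
    (radial_proj x) - radial_proj x 0 j * df i (radial_proj x)).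
Proof. by rewrite eq_sym /dwf !mxE; ring. Qed.

Lemma C1_at_xwf i x :
  C1_at (fun y => y 0 i * wf y) (fun j y => (j == i)%:R * wf y + y 0 i * dwf j y) x.
Proof. exact: C1_at_mul (C1_at_coord i x) (C1_at_wf x). Qed.

End Field.

Lemma xwf_out (f : 'rV[R]_n -> R) i j x : 1 <= `|x 0 j| ->
  x 0 i * (weight x * f (radial_proj x)) = 0.
Proof.
move=> h; rewrite weight_out ?mul0r ?mulr0 //.
apply: le_trans (sqnorm_coord x j).
by rewrite -(real_normK (num_real (x 0 j))) exprn_ege1.
Qed.

End Weight.

(** * Averages over a cubic grid *)

Section Grid.
Context {R : realType} {n : nat}.
Implicit Types (x y : 'rV[R]_n) (f : 'rV[R]_n -> R) (N : nat).
Notation e_ i := (delta_mx 0 i : 'rV[R]_n).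
Notation grid N := {ffun 'I_n -> 'I_(N + N)}.

(** The grid of mesh 1/N in the cube [-1, 1)^n. *)
Definition grid_pt N (k : grid N) : 'rV[R]_n := \row_i ((k i)%:R / N%:R - 1).
Definition grid_sum N f : R := \sum_(k : grid N) f (grid_pt k).

Lemma grid_pt_le1 N (k : grid N) : `|grid_pt k| <= 1.
Proof.
apply: norm_le_coord => // i; rewrite mxE.
have N0 : 0 < N%:R :> R.
  rewrite ltr0n; case: N k => // k; by have := ltn_ord (k i).
have h1 : 0 <= (k i)%:R / N%:R :> R by rewrite divr_ge0 // ltW.
have h2 : (k i)%:R / N%:R <= 2 :> R.
  rewrite ler_pdivrMr // mulr2n mulrDl mul1r -natrD ler_nat.
  exact: ltnW (ltn_ord _).
by rewrite ler_norml; lra.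
Qed.

(** A cyclic shift, in order to be a bijection of the grid. *)
Definition grid_shift N (j : 'I_n) (k : grid N) : grid N :=
  [ffun i => if i == j then ordS (k i) else k i].

Lemma grid_shift_inj N j : injective (@grid_shift N j).
Proof.
move=> k l E; apply/ffunP => i; have := congr1 (fun h : grid N => h i) E.
by rewrite !ffunE; case: (i == j) => // /ordS_inj.
Qed.

(** The cyclic shift and the translation differ only on the faces of the cube,
    where [f] vanishes. *)
Lemma grid_sum_shift N f j : (0 < N)%N -> (forall x, 1 <= `|x 0 j| -> f x = 0) ->
  \sum_(k : grid N) f (grid_pt k + N%:R^-1 *: e_ j) = grid_sum N f.
Proof.
move=> N0 f0; rewrite /grid_sum [RHS](reindex_inj (@grid_shift_inj N j)) /=.
apply: eq_bigr => k _.
have N0' : N%:R != 0 :> R by rewrite pnatr_eq0 -lt0n.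
have [h|h] := ltnP (k j).+1 (N + N).
  congr f; apply/rowP => i; rewrite !mxE !ffunE eqxx /=.
  case: eqVneq => [->|ij]; last by rewrite mulr0 addr0.
  by rewrite mulr1 /= modn_small // -natr1 mulrDl mul1r addrAC.
have E : (k j).+1 = (N + N)%N by apply/eqP; rewrite eqn_leq h ltn_ord.
have -> : f (grid_pt (grid_shift j k)) = 0.
  by apply: f0; rewrite !mxE !ffunE eqxx /= E modnn mul0r sub0r normrN normr1.
apply: f0; rewrite !mxE !eqxx mulr1 /=.
have -> : (k j)%:R / N%:R - 1 + N%:R^-1 = 1 :> R.
  have H : (k j)%:R + 1 = N%:R + N%:R :> R by rewrite natr1 E natrD.
  have -> : (k j)%:R = N%:R + N%:R - 1 :> R by rewrite -H addrK.
  by field.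
by rewrite normr1.
Qed.

(** The partial derivative at a grid point is, up to an error that is uniformly
    small on a fine grid, N times the increment to the next grid point; the sum
    of these increments is zero. *)
Lemma grid_sum_partial_small f df j : (forall x, C1_at f df x) ->
  (forall x, 1 <= `|x 0 j| -> f x = 0) ->
  forall e : R, 0 < e -> exists N0, forall N, (N0 < N)%N ->
    `|grid_sum N (df j)| <= e * (N + N)%:R ^+ n.
Proof.
move=> F f0 e e0.
pose K := [set x : 'rV[R]_n | `|x| <= 1].
have cK : compact K.
  apply: bounded_closed_compact.
    exists 1; split; first exact: num_real.
    by move=> M M1 x /= xK; exact: le_trans xK (ltW M1).
  have -> : K = (fun x : 'rV[R]_n => `|x|) @^-1` [set t | t <= 1] by [].
  apply: preimage_closed; last exact: closed_le.
  by move=> x _; exact: norm_continuous.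
have cdf x : K x -> {for x, continuous (df j)} by case: (F x) => _ /(_ j) [].
have [d d0 Hd] := compact_unif cK cdf e0.
exists (Num.truncn (d^-1)) => N HN.
have N0 : (0 < N)%N by exact: leq_ltn_trans HN.
have Nr0 : 0 < N%:R :> R by rewrite ltr0n.
have Nd : N%:R^-1 < d.
  rewrite -[d]invrK ltf_pV2 ?posrE ?invr_gt0 //.
  apply: lt_le_trans (truncnS_gt _) _.
  by rewrite ler_nat.
have -> : grid_sum N (df j) = \sum_(k : grid N)
   (df j (grid_pt k) - N%:R * (f (grid_pt k + N%:R^-1 *: e_ j) - f (grid_pt k))).
  rewrite big_split /= sumrN -mulr_sumr big_split /= sumrN.
  by rewrite grid_sum_shift // subrr mulr0 subr0.
apply: le_trans (ler_norm_sum _ _ _) _.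
have -> : e * (N + N)%:R ^+ n = \sum_(k : grid N) e.
  by rewrite sumr_const card_ffun !card_ord -[RHS]mulr_natr natrX.
apply: ler_sum => k _.
have [t tN] := @line_MVT R n f (df j) (grid_pt k) (e_ j) N%:R^-1
  (fun t _ => (let: conj a b := F (grid_pt k + t *: e_ j) in
     DeriveDef (diff_derivable (v := e_ j) a) (b j).1)).
move=> ->; rewrite [df j _ * _]mulrC mulrA mulfV ?gt_eqF // mul1r.
apply: ltW; apply: Hd; first exact: grid_pt_le1.
rewrite opprD addNKr normrN normrZ.
apply: le_lt_trans Nd; rewrite -[leRHS]mulr1.
apply: ler_pM => //; last exact: norm_e.
by apply: le_trans tN _; rewrite ger0_norm // invr_ge0 ltW.
Qed.

End Grid.

(** * The total weight of a grid *)
Section WeightMass.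
Context {R : realType} {n : nat}.
Hypothesis n2 : (2 <= n)%N.
Notation e_ i := (delta_mx 0 i : 'rV[R]_n).
Notation grid N := {ffun 'I_n -> 'I_(N + N)}.

Lemma small_cube (x : 'rV[R]_n) :
  (forall i, (2 * n%:R)^-1 <= x 0 i /\ x 0 i <= n%:R^-1) ->
  (1/4) * (shell (R := R) (n := n)) ^+ 2 <= weight x.
Proof.
move=> H; have n0 := @dim_gt0 R n n2.
have q0 : 0 < n%:R^-1 :> R by rewrite invr_gt0.
have q2 : n%:R^-1 <= 1/2 :> R.
  by rewrite mul1r lef_pV2 ?posrE // ler_nat.
have lo : (4 * n%:R)^-1 <= sqnorm x.
  have -> : (4 * n%:R)^-1 = \sum_(i < n) (2 * n%:R)^-1 ^+ 2 :> R.
    rewrite sumr_const card_ord -[RHS]mulr_natr; field.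
    by rewrite gt_eqF.
  apply: ler_sum => i _; have [h _] := H i.
  by rewrite lerXn2r // nnegrE ?invr_ge0 ?mulr_ge0 ?(ltW n0) //
     (le_trans _ h) // invr_ge0 mulr_ge0 // ltW.
have hi : sqnorm x <= n%:R^-1.
  have -> : n%:R^-1 = \sum_(i < n) n%:R^-1 ^+ 2 :> R.
    rewrite sumr_const card_ord -[RHS]mulr_natr; field.
    by rewrite gt_eqF.
  apply: ler_sum => i _; have [h1 h2] := H i.
  have h3 : 0 <= x 0 i by apply: le_trans h1; rewrite invr_ge0 mulr_ge0 // ltW.
  by rewrite lerXn2r // nnegrE // invr_ge0 ltW.
have s0 := @shell_gt0 R n n2.
have sE : (4 * n%:R)^-1 = 2 * shell (R := R) (n := n).
  by rewrite /shell; field; rewrite gt_eqF.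
rewrite /weight; apply: ler_pM; rewrite ?sqr_ge0 //.
  have -> : 1/4 = (1/2) ^+ 2 :> R by field.
  by apply: pos_part_sq_ge; lra.
by apply: pos_part_sq_ge => //; lra.
Qed.

(** When N is a multiple of 2n, the cube [1/(2n), 1/n)^n contains a fixed
    proportion of the grid points. *)
Lemma grid_sum_weight (m : nat) : (0 < m)%N ->
  (1/4) * shell (R := R) (n := n) ^+ 2 * (4 * n%:R)^-1 ^+ n *
    ((2 * n * m) + (2 * n * m))%:R ^+ n
   <= grid_sum (R := R) (n := n) (2 * n * m) weight.
Proof.
move=> m0; set N := (2 * n * m)%N; have nr0 := @dim_gt0 R n n2.
have N0 : (0 < N)%N by rewrite /N !muln_gt0 m0; case: n n2.
have lt_cell (l : 'I_m) : (N + m + l < N + N)%N.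
  by have := ltn_ord l; rewrite /N; nia.
pose iota (l : {ffun 'I_n -> 'I_m}) : grid N := [ffun i => Ordinal (lt_cell (l i))].
have iota_inj : injective iota.
  move=> k l E; apply/ffunP => i; have := congr1 (fun h : grid N => val (h i)) E.
  by rewrite !ffunE /= => /addnI /val_inj.
have mr0 : 0 < m%:R :> R by rewrite ltr0n.
have wi (l : {ffun 'I_n -> 'I_m}) :
    (1/4) * shell (R := R) (n := n) ^+ 2 <= weight (grid_pt (R := R) (iota l)).
  apply: small_cube => i; rewrite mxE !ffunE /=.
  have -> : (N + m + l i)%:R / N%:R - 1 = (m%:R + (l i)%:R) / N%:R :> R.
    by rewrite !natrD /N !natrM; field; rewrite !gt_eqF.
  have h1 : (l i)%:R <= m%:R :> R by rewrite ler_nat ltnW.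
  have h2 : 0 <= (l i)%:R :> R by [].
  have Nr : 0 < N%:R :> R by rewrite ltr0n.
  split.
    rewrite ler_pdivlMr //.
    have -> : (2 * n%:R)^-1 * N%:R = m%:R :> R.
      by rewrite /N !natrM; field; rewrite gt_eqF.
    by lra.
  rewrite ler_pdivrMr //.
  have -> : n%:R^-1 * N%:R = 2 * m%:R :> R.
    by rewrite /N !natrM; field; rewrite gt_eqF.
  by lra.
rewrite /grid_sum (bigID (fun k => k \in [set iota l | l in [set: {ffun 'I_n ->
  'I_m}]]%SET)) /=.
apply: ler_wpDr; first by apply: sumr_ge0 => k _; exact: weight_ge0.
rewrite big_imset /=; last by move=> k l _ _; exact: iota_inj.
apply: le_trans (ler_sum _ (fun l _ => wi l)).
under eq_bigl do rewrite finset.in_setT.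
rewrite sumr_const card_ffun !card_ord -[leRHS]mulr_natr -mulrA.
apply: ler_wpM2l; first by rewrite mulr_ge0 // sqr_ge0.
rewrite -exprMn natrX.
have -> // : (4 * n%:R)^-1 * (N + N)%:R = m%:R :> R.
by rewrite natrD /N !natrM; field; rewrite gt_eqF.
Qed.

End WeightMass.

(** * The mean over the unit sphere *)
Lemma ultra_fmap (T V : Type) (h : T -> V) (F : set_system T) :
  UltraFilter F -> UltraFilter (h @ F).
Proof.
move=> FU; split=> [|G GF sub].
  exact: fmap_proper_filter.
rewrite predeqE => A; split; last exact: sub.
move=> GA; have [//|nA] := in_ultra_setVsetC (h @^-1` A) FU.
have /filter_ex [? []//] : G (A `&` ~` A).
by apply: filterI => //; apply: sub.
Qed.

Section Mean.
Context {R : realType} {n : nat}.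
Implicit Types (f g : 'rV[R]_n -> R) (x : 'rV[R]_n).

Definition sphere_bounded f := exists B : R, forall x, enorm x = 1 -> `|f x| <= B.

(** [L] is a total operation on functions, linear on those that are bounded on the
    sphere.  Invariance under rotations is stated infinitesimally. *)
Record sphere_mean (L : ('rV[R]_n -> R) -> R) : Prop := SphereMean {
  mean_add : forall f g, sphere_bounded f -> sphere_bounded g ->
    L (fun x => f x + g x) = L f + L g;
  mean_scale : forall (c : R) f, sphere_bounded f -> L (fun x => c * f x) = c * L f;
  mean_ge0 : forall f, sphere_bounded f -> (forall x, enorm x = 1 -> 0 <=
    f x) -> 0 <= L f;
  mean_1 : L (fun=> 1) = 1;
  mean_rot : forall f df, (forall x, enorm x = 1 -> C1_at f df x) ->
    forall i j, L (fun x => x 0 i * df j x - x 0 j * df i x) = 0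
}.

Section Existence.
Hypothesis n2 : (2 <= n)%N.

Let N M := (2 * n * M.+1)%N.
Let W M : R := grid_sum (R := R) (n := n) (N M) weight.
Let wmean M f : R := grid_sum (N M) (fun x => weight x * f (radial_proj x)) / W M.

Let c0 : R := (1/4) * shell (R := R) (n := n) ^+ 2 * (4 * n%:R)^-1 ^+ n.

Let c0_gt0 : 0 < c0.
Proof.
have h := @dim_gt0 R n n2; have s := @shell_gt0 R n n2.
by rewrite !mulr_gt0 // ?exprn_gt0 // invr_gt0 mulr_gt0.
Qed.

Let N0 M : (0 < N M)%N.
Proof. by rewrite /N !muln_gt0 /=; case: n n2. Qed.

Let W_ge M : c0 * (N M + N M)%:R ^+ n <= W M.
Proof. by apply: grid_sum_weight. Qed.

Let W_gt0 M : 0 < W M.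
Proof.
apply: lt_le_trans (W_ge M); rewrite mulr_gt0 // exprn_gt0 // ltr0n addn_gt0.
by rewrite N0.
Qed.

Let wmean_add M f g : wmean M (fun x => f x + g x) = wmean M f + wmean M g.
Proof.
rewrite /wmean -mulrDl -big_split; congr (_ / _).
by apply: eq_bigr => k _ /=; rewrite mulrDr.
Qed.

Let wmean_scale M c f : wmean M (fun x => c * f x) = c * wmean M f.
Proof.
rewrite /wmean mulrA mulr_sumr; congr (_ / _).
by apply: eq_bigr => k _ /=; rewrite mulrCA.
Qed.

Let wmean_ge0 M f : (forall x, enorm x = 1 -> 0 <= f x) -> 0 <= wmean M f.
Proof.
move=> f0; rewrite /wmean divr_ge0 ?(ltW (W_gt0 M)) //; apply: sumr_ge0 => k _.
have [->|/weight_neq0 h] := eqVneq (weight (grid_pt (R := R) k)) 0.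
  by rewrite mul0r.
by rewrite mulr_ge0 ?weight_ge0 // f0 // radial_proj_sphere // h.
Qed.

Let wmean_1 M : wmean M (fun=> 1) = 1.
Proof.
rewrite /wmean -[RHS](@mulfV _ (W M)) ?gt_eqF //; congr (_ / _).
by apply: eq_bigr => k _; rewrite mulr1.
Qed.

(** From positivity, applied to B - f and B + f. *)
Let wmean_le M f (B : R) : (forall x, enorm x = 1 -> `|f x| <= B) ->
  `|wmean M f| <= B.
Proof.
move=> fB.
have h (s : R) : `|s| = 1 -> s * wmean M f <= B.
  move=> s1; rewrite -subr_ge0.
  have -> : B - s * wmean M f = wmean M (fun x => B * 1 + (- s) * f x).
    by rewrite wmean_add !wmean_scale wmean_1 mulr1 mulNr.
  apply: wmean_ge0 => x /fB xB; rewrite mulr1 mulNr subr_ge0.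
  by apply: le_trans (ler_norm _) _; rewrite normrM s1 mul1r.
rewrite ler_norml; have := h 1; have := h (-1).
by rewrite normrN normr1 mul1r mulN1r => /(_ erefl) h1 /(_ erefl) h2; lra.
Qed.

(** The numerator is the grid sum of a divergence, which is small compared with
    the number of grid points, while the denominator is comparable to it. *)
Let wmean_rot f df : (forall x, enorm x = 1 -> C1_at f df x) -> forall i j,
  wmean M (fun x => x 0 i * df j x - x 0 j * df i x) @[M --> \oo] --> (0 : R).
Proof.
move=> F i j; apply/cvgr0Pnorm_le => e e0.
have e1 : 0 < e * c0 / 2 by rewrite divr_gt0 // mulr_gt0.
have [M1 H1] := @grid_sum_partial_small R n _ _ j (C1_at_xwf n2 F i)
  (@xwf_out R n f i j) _ e1.
have [M2 H2] := @grid_sum_partial_small R n _ _ i (C1_at_xwf n2 F j)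
  (@xwf_out R n f j i) _ e1.
near=> M.
have NM : (M < N M)%N by rewrite /N; case: n n2 => // n' _; nia.
have M1N : (M1 < N M)%N.
  by apply: leq_ltn_trans NM; near: M; exact: nbhs_infty_ge.
have M2N : (M2 < N M)%N.
  by apply: leq_ltn_trans NM; near: M; exact: nbhs_infty_ge.
have := H1 _ M1N; have := H2 _ M2N.
set g1 := grid_sum _ _; set g2 := grid_sum _ _ => h1 h2.
rewrite /wmean normrM normfV (ger0_norm (ltW (W_gt0 M))) ler_pdivrMr //.
have -> : grid_sum (N M) (fun x => weight x *
    (radial_proj x 0 i * df j (radial_proj x) - radial_proj x 0 j * df i
      (radial_proj x))) = g2 - g1.
  rewrite /g1 /g2 /grid_sum -sumrB; apply: eq_bigr => k _.
  by rewrite -(@rot_field R n f df i j (grid_pt k)).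
apply: le_trans (ler_normB _ _) _.
have := W_ge M; rewrite -(ler_pM2l e0); lra.
Unshelve. all: by end_near. Qed.

(** The averages of a bounded function stay in a compact interval, so they
    converge along any ultrafilter; taking one that refines the filter of
    neighbourhoods of infinity preserves genuine limits. *)
Theorem sphere_mean_exists : exists L, sphere_mean L.
Proof.
have [U [UU UF]] := @ultraFilterLemma nat \oo _.
have UP : ProperFilter U by exact: ultra_proper.
have cv f : sphere_bounded f -> cvg (wmean M f @[M --> U]).
  move=> [B fB]; have K := @segment_compact R (- B) B.
  rewrite compact_ultra in K.
  have [|l [_ lH]] := K _ (ultra_fmap (fun M => wmean M f) UU).
    suff : \forall M \near U, wmean M f \in `[- B, B] by [].
    apply: filterE => M; rewrite in_itv /= -ler_norml.
    by have := wmean_le M fB.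
  by apply/cvg_ex; exists l.
exists (fun f => lim (wmean M f @[M --> U])); split.
- move=> f g bf bg.
  have -> : (fun M => wmean M (fun x => f x + g x)) =
    (fun M => wmean M f + wmean M g) by apply/funext => M; exact: wmean_add.
  by apply: cvg_lim => //; apply: cvgD; exact: cv.
- move=> c f bf.
  have -> : (fun M => wmean M (fun x => c * f x)) =
    (fun M => c * wmean M f) by apply/funext => M; exact: wmean_scale.
  by apply: cvg_lim => //; apply: cvgM; [exact: cvg_cst|exact: cv].
- move=> f bf f0; apply: limr_ge; first exact: cv.
  by apply: filterE => M; exact: wmean_ge0.
- have -> : (fun M => wmean M (fun=> 1)) = (fun=> 1).
    by apply/funext => M; exact: wmean_1.
  by apply: cvg_lim => //; exact: cvg_cst.
- move=> f df F i j; apply: cvg_lim => //.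
  by apply: cvg_trans (wmean_rot F i j) => A /=; exact: UF.
Qed.

End Existence.
End Mean.

(** * Calculus with spherical means *)
Section Bounded.
Context {R : realType} {n : nat}.
Implicit Types (f g : 'rV[R]_n -> R) (x : 'rV[R]_n).

Lemma sphere_bounded_cst (c : R) : sphere_bounded (fun _ : 'rV[R]_n => c).
Proof. by exists `|c|. Qed.

Lemma sphere_bounded_coord i : sphere_bounded (fun x : 'rV[R]_n => x 0 i).
Proof. by exists 1 => x <-; exact: coord_le_enorm. Qed.

Lemma sphere_bounded_add f g : sphere_bounded f -> sphere_bounded g ->
  sphere_bounded (fun x => f x + g x).
Proof.
move=> [A fA] [B gB]; exists (A + B) => x x1.
by apply: le_trans (ler_normD _ _) _; rewrite lerD ?fA ?gB.
Qed.

Lemma sphere_bounded_mul f g : sphere_bounded f -> sphere_bounded g ->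
  sphere_bounded (fun x => f x * g x).
Proof.
move=> [A fA] [B gB]; exists (A * B) => x x1.
by rewrite normrM; apply: ler_pM; rewrite ?fA ?gB.
Qed.

Lemma sphere_bounded_opp f : sphere_bounded f -> sphere_bounded (fun x => - f x).
Proof. by move=> [A fA]; exists A => x x1; rewrite normrN fA. Qed.

Lemma sphere_bounded_sub f g : sphere_bounded f -> sphere_bounded g ->
  sphere_bounded (fun x => f x - g x).
Proof. by move=> bf bg; apply: sphere_bounded_add => //;
  exact: sphere_bounded_opp. Qed.

Lemma sphere_bounded_sum m (F : 'I_m -> 'rV[R]_n -> R) : (forall i,
  sphere_bounded (F i)) ->
  sphere_bounded (fun x => \sum_i F i x).
Proof.
move=> H; have /choice [B HB] := H; exists (\sum_i B i) => x x1.
by apply: le_trans (ler_norm_sum _ _ _) _; apply: ler_sum => i _; exact: HB.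
Qed.

Lemma compact_ball (r : R) : compact [set x : 'rV[R]_n | enorm x <= r].
Proof.
apply: bounded_closed_compact.
  exists r; split; first exact: num_real.
  move=> M rM x /= xr; apply: le_trans (norm_le_enorm x) _.
  exact: le_trans xr (ltW rM).
have -> : [set x : 'rV[R]_n | enorm x <= r] = (@enorm R n) @^-1` [set t | t <= r].
  by [].
apply: preimage_closed; last exact: closed_le.
by move=> x _; exact: enorm_cont.
Qed.

Lemma compact_sphere : compact [set x : 'rV[R]_n | enorm x = 1].
Proof.
apply: subclosed_compact (@compact_ball 1) _ => [|x /= ->//].
have -> : [set x : 'rV[R]_n | enorm x = 1] = (@enorm R n) @^-1` [set t | t = 1].
  by [].
apply: preimage_closed; last exact: closed_eq.
by move=> x _; exact: enorm_cont.
Qed.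

Lemma sphere_bounded_cont f : (forall x, enorm x = 1 -> {for x,
  continuous f}) -> sphere_bounded f.
Proof.
move=> fc.
have : compact (f @` [set x | enorm x = 1]).
  apply: continuous_compact; last exact: compact_sphere.
  apply: continuous_in_subspaceT => x /set_mem; exact: fc.
move=> /compact_bounded [M [_ H]]; exists (M + 1) => x x1.
by apply: (H (M + 1)); [rewrite ltrDl|exists x].
Qed.

Definition C1_sphere f df := forall x, enorm x = 1 -> C1_at f df x.

Lemma C1_sphere_bnd f df : C1_sphere f df -> sphere_bounded f.
Proof. by move=> F; apply: sphere_bounded_cont => x /F; exact: C1_at_cont. Qed.

Lemma C1_sphere_bndd f df i : C1_sphere f df -> sphere_bounded (df i).
Proof. by move=> F; apply: sphere_bounded_cont => x /F [_ /(_ i) []]. Qed.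

End Bounded.

(** Boundedness on the sphere of the expressions to which the mean is applied. *)
Ltac bnd := repeat first
  [ assumption | apply: sphere_bounded_cst | apply: sphere_bounded_coord
  | apply: sphere_bounded_sub | apply: sphere_bounded_add | apply: sphere_bounded_mul
  | apply: sphere_bounded_opp | (apply: sphere_bounded_sum => ?) ].

Section MeanTheory.
Context {R : realType} {n : nat}.
Implicit Types (f g : 'rV[R]_n -> R) (x : 'rV[R]_n).
Variable L : ('rV[R]_n -> R) -> R.
Hypothesis HL : sphere_mean L.

Lemma mean_opp f : sphere_bounded f -> L (fun x => - f x) = - L f.
Proof.
move=> bf; have := mean_scale HL (-1) bf; rewrite mulN1r => <-.
by congr L; apply/funext => x; rewrite mulN1r.
Qed.

Lemma mean_sub f g : sphere_bounded f -> sphere_bounded g -> L (fun x =>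
  f x - g x) = L f - L g.
Proof.
by move=> bf bg; rewrite (mean_add HL) ?mean_opp //; exact: sphere_bounded_opp.
Qed.

Lemma mean_le f g : sphere_bounded f -> sphere_bounded g ->
  (forall x, enorm x = 1 -> f x <= g x) -> L f <= L g.
Proof.
move=> bf bg fg; rewrite -subr_ge0 -mean_sub //; apply: (mean_ge0 HL); first bnd.
by move=> x /fg; rewrite subr_ge0.
Qed.

Lemma mean_eq f g : sphere_bounded f -> sphere_bounded g ->
  (forall x, enorm x = 1 -> f x = g x) -> L f = L g.
Proof.
by move=> bf bg fg; apply/eqP; rewrite eq_le; apply/andP; split;
  apply: mean_le => // x /fg ->.
Qed.

Lemma mean_cst (c : R) : L (fun=> c) = c.
Proof.
rewrite -[RHS]mulr1 -(mean_1 HL) -(mean_scale HL); last bnd.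
by congr L; apply/funext => x; rewrite mulr1.
Qed.

Lemma mean_norm f (B : R) : sphere_bounded f -> (forall x, enorm x = 1 ->
  `|f x| <= B) ->
  `|L f| <= B.
Proof.
move=> bf fB; rewrite ler_norml -{2}(mean_cst B) -(mean_cst (- B)).
by apply/andP; split; apply: mean_le; bnd; move=> x /fB; rewrite ler_norml =>
  /andP[].
Qed.

Lemma mean_sum m (F : 'I_m -> 'rV[R]_n -> R) : (forall i, sphere_bounded (F i)) ->
  L (fun x => \sum_i F i x) = \sum_i L (F i).
Proof.
elim: m F => [|m IH] F H.
  rewrite big_ord0 -[RHS](mean_cst 0); congr L.
  by apply/funext => x; rewrite big_ord0.
rewrite big_ord_recl -IH // -(mean_add HL); bnd.
- by congr L; apply/funext => x; rewrite big_ord_recl.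
- exact: H.
- exact: H.
Qed.

Lemma sphere_sqnorm x : enorm x = 1 -> \sum_i x 0 i ^+ 2 = 1.
Proof. by move=> x1; rewrite -[LHS]/(sqnorm x) -enorm_sq x1 expr1n. Qed.

(** Integration by parts on the sphere.  The left hand side is the mean of the
    k-th component of the tangential gradient; summing the invariance of the mean
    under x_i d_k - x_k d_i, applied to x_i f, over i leaves the curvature term
    (n - 1) x_k f. *)
Lemma mean_tangent f df k : C1_sphere f df ->
  L (fun x => df k x - x 0 k * \sum_i x 0 i * df i x)
  = (n%:R - 1) * L (fun x => x 0 k * f x).
Proof.
move=> F; have bf := C1_sphere_bnd F; have bdf i := C1_sphere_bndd i F.
have rot i : L (fun x => x 0 i * ((k == i)%:R * f x + x 0 i * df k x)
                   - x 0 k * ((i == i)%:R * f x + x 0 i * df i x)) = 0.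
  refine (@mean_rot _ _ _ HL (fun x => x 0 i * f x)
    (fun j x => (j == i)%:R * f x + x 0 i * df j x) _ i k) => x x1.
  exact: C1_at_mul (C1_at_coord i x) (F x x1).
have : L (fun x => \sum_i (x 0 i * ((k == i)%:R * f x + x 0 i * df k x)
                   - x 0 k * ((i == i)%:R * f x + x 0 i * df i x))) = 0.
  by rewrite mean_sum => [|i]; [rewrite big1|bnd; exact: bdf].
move=> E; apply/eqP; rewrite -subr_eq0 -(mean_scale HL) -?mean_sub; bnd;
  try exact: bdf.
apply/eqP; rewrite -[RHS]E; apply: mean_eq; bnd; try exact: bdf.
move=> x x1; rewrite sumrB.
under [X in _ = X - _]eq_bigr do rewrite mulrDr.
under [X in _ = _ - X]eq_bigr do rewrite eqxx mul1r mulrDr.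
rewrite !big_split /= sumr_const card_ord -mulr_sumr.
rewrite [X in _ = X + _ - _](bigD1 k) //= [X in _ = _ + X + _ - _]big1 ?eqxx =>
  [|i ik]; last first.
  by rewrite eq_sym (negbTE ik) mul0r mulr0.
have -> : \sum_(i < n) x 0 i * (x 0 i * df k x) = df k x.
  rewrite -[RHS]mul1r -(sphere_sqnorm x1) mulr_suml.
  by apply: eq_bigr => i _; rewrite mulrA.
by rewrite (_ : true%:R = 1 :> R) // -[_ *+ n]mulr_natl; ring.
Qed.

Lemma scale_in_ball (r : R) x : `|r| < 1 -> enorm x = 1 -> enorm (r *: x) < 1.
Proof. by move=> r1 x1; rewrite enormZ x1 mulr1. Qed.

Lemma cont_scale (F : 'rV[R]_n -> R) dF (r : R) x : (forall y, enorm y < 1 ->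
  C1_at F dF y) ->
  `|r| < 1 -> enorm x = 1 -> {for x, continuous (fun y : 'rV[R]_n => F (r *: y))}.
Proof.
move=> HF r1 x1; apply: continuous_comp; first exact: scaler_continuous.
exact: C1_at_cont (HF _ (scale_in_ball r1 x1)).
Qed.

Lemma sphere_bounded_scale (F : 'rV[R]_n -> R) dF (r : R) : (forall y,
  enorm y < 1 -> C1_at F dF y) ->
  `|r| < 1 -> sphere_bounded (fun y => F (r *: y)).
Proof. by move=> HF r1; apply: sphere_bounded_cont => x x1;
  exact: cont_scale HF r1 x1. Qed.

Lemma sphere_bounded_scaled (F : 'rV[R]_n -> R) dF (r : R) i : (forall y,
  enorm y < 1 -> C1_at F dF y) ->
  `|r| < 1 -> sphere_bounded (fun y => dF i (r *: y)).
Proof.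
move=> HF r1; apply: sphere_bounded_cont => x x1.
apply: continuous_comp; first exact: scaler_continuous.
by have [_ /(_ i) []] := HF _ (scale_in_ball r1 x1).
Qed.

(** Uniformity over the sphere of the difference quotients in the radius: by the
    mean value theorem along each ray, and uniform continuity of the partial
    derivatives on a slightly larger ball. *)
Lemma radial_quotient (F : 'rV[R]_n -> R) dF (r : R) :
  (forall y, enorm y < 1 -> C1_at F dF y) ->
  `|r| < 1 -> forall e : R, 0 < e -> exists2 d : R, 0 < d &
    forall t : R, `|t| < d -> t != 0 -> `|r + t| < 1 /\
    forall x, enorm x = 1 ->
    `|t^-1 * (F ((r + t) *: x) - F (r *: x)) - \sum_i x 0 i * dF i (r *: x)| <= e.
Proof.
move=> HF r1 e e0.
have e1 : 0 < e / (n%:R + 1) by rewrite divr_gt0 // ltr_wpDl.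
pose r2 := (1 + `|r|) / 2.
have r21 : r2 < 1 by rewrite /r2; lra.
have rr2 : `|r| < r2 by rewrite /r2; lra.
have UC i : exists d : R, 0 < d /\ forall x y, enorm x <= r2 -> `|x - y| < d ->
    `|dF i x - dF i y| < e / (n%:R + 1).
  have [|d d0 H] := @compact_unif R n _ (dF i) (compact_ball (r := r2)) _ _ e1.
    by move=> x /= xr; have [_ /(_ i) []] := HF x (le_lt_trans xr r21).
  by exists d; split.
have /choice [dd Hdd] := UC.
have [d [d0 Hd]] : exists d : R, 0 < d /\ forall i, d <= dd i.
  exists (\big[Num.min/1]_i dd i); split.
    by elim/big_ind: _ => // [a b a0 b0|i _]; [rewrite lt_min a0|case: (Hdd i)].
  by move=> i; apply: bigmin_le_cond.
exists (Num.min d (r2 - `|r|)); first by rewrite lt_min d0 subr_gt0.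
move=> t; rewrite lt_min => /andP[td tr] t0.
have rt (s : R) : `|s| <= `|t| -> `|r + s| <= r2.
  by move=> st; apply: le_trans (ler_normD _ _) _; lra.
split; first exact: le_lt_trans (rt t (lexx _)) r21.
move=> x x1.
have D (s : R) : `|s| <= `|t| -> is_derive (r *: x + s *: x) x F
    (\sum_i x 0 i * dF i (r *: x + s *: x)).
  move=> st; apply: C1_at_is_derive; apply: HF.
  by rewrite -scalerDl enormZ x1 mulr1 (le_lt_trans (rt s st)).
have [s st E] := @line_MVT R n F (fun y => \sum_i x 0 i * dF i y) (r *: x) x t D.
rewrite scalerDl E [_ * t]mulrC mulKf // -sumrB.
apply: le_trans (ler_norm_sum _ _ _) _.
apply: (@le_trans _ _ (\sum_(i < n) (e / (n%:R + 1)))).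
  apply: ler_sum => i _; rewrite -mulrBr normrM.
  rewrite -[leRHS]mul1r; apply: ler_pM => //.
    by rewrite -x1; exact: coord_le_enorm.
  rewrite distrC; apply: ltW; apply: (Hdd i).2.
    by rewrite enormZ x1 mulr1 ltW.
  rewrite opprD addNKr normrN normrZ.
  apply: (@le_lt_trans _ _ `|t|); last exact: lt_le_trans td (Hd i).
  rewrite -[leRHS]mulr1; apply: ler_pM => //.
  by rewrite -x1; exact: norm_le_enorm.
rewrite sumr_const card_ord -[X in X <= _]mulr_natr -mulrA ler_piMr ?(ltW e0) //.
by rewrite mulrC ler_pdivrMr ?ltr_wpDl // mul1r lerDl.
Qed.

(** The mean is continuous for the uniform norm, so that it commutes with the
    derivative in the radius. *)
Lemma mean_radial (c F : 'rV[R]_n -> R) dF (r : R) : sphere_bounded c ->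
  (forall y, enorm y < 1 -> C1_at F dF y) -> `|r| < 1 ->
  is_derive r 1 (fun s => L (fun x => c x * F (s *: x)))
    (L (fun x => c x * \sum_i x 0 i * dF i (r *: x))).
Proof.
move=> bc HF r1; have [B HB] := bc.
set Phi := fun s => _; set l := L _.
have B1 : 0 < `|B| + 1 by rewrite ltr_wpDl.
have H : h^-1 *: ((Phi \o shift r) (h *: 1) - Phi r) @[h --> 0^'] --> l.
  apply/cvgrPdist_le => e e0.
  have e1 : 0 < e / (`|B| + 1) by rewrite divr_gt0.
  have [d d0 Hd] := radial_quotient HF r1 e1.
  near=> t.
  have t0 : t != 0 by near: t; exact: nbhs_dnbhs_neq.
  have td : `|t| < d by near: t; exact: dnbhs0_lt.
  have [rt Ht] := Hd t td t0.
  have bS := sphere_bounded_scale HF r1; have bT := sphere_bounded_scale HF rt.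
  have bD i := sphere_bounded_scaled i HF r1.
  have -> : l - t^-1 *: ((Phi \o shift r) (t *: 1) - Phi r) =
     L (fun x => c x * (\sum_i x 0 i * dF i (r *: x) -
          t^-1 * (F ((r + t) *: x) - F (r *: x)))).
    have -> : (Phi \o shift r) (t *: 1) = Phi (r + t).
      by rewrite /= [_%:A]mulr1 addrC.
    rewrite -[t^-1 *: _]/(t^-1 * (Phi (r + t) - Phi r)) /l /Phi.
    rewrite -mean_sub -?(mean_scale HL) -?mean_sub; bnd; try exact: bD.
    by congr L; apply/funext => x; ring.
  apply: mean_norm => [|x x1]; first by bnd; exact: bD.
  rewrite normrM distrC.
  have h1 := Ht x x1; have h2 := HB x x1.
  have -> : e = (`|B| + 1) * (e / (`|B| + 1)) by rewrite mulrC divfK // gt_eqF.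
  apply: ler_pM => //; apply: le_trans h2 _.
  by apply: le_trans (ler_norm B) _; rewrite lerDl.
by split; [apply/cvg_ex; exists l|apply: cvg_lim].
Unshelve. all: by end_near. Qed.

End MeanTheory.

(** * The mean distance of a coordinate to a constant *)
Section CapProfile.
Context {R : realType}.
Variable s : R.
Hypothesis s1 : `|s| < 1.

Let sl : -1 < s. Proof. by move: s1; rewrite ltr_norml => /andP[]. Qed.
Let sr : s < 1. Proof. by move: s1; rewrite ltr_norml => /andP[]. Qed.

Let pl : 0 < 1 - s. Proof. by have := sr; lra. Qed.
Let pr : 0 < 1 + s. Proof. by have := sl; lra. Qed.

(** The two branches, below and above [s], of the solution of
    ((1 - t^2) g)' = |t - s| - (1 + s^2)/2 that is regular at both ends of
    [-1, 1].  The constant (1 + s^2)/2 is the mean of |t - s| on [-1, 1], which is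
    what makes such a solution exist. *)
Let gl (t : R) := 1/2 - (1 - s) ^+ 2 / 2 * (1 - t)^-1.
Let gr (t : R) := (1 + s) ^+ 2 / 2 * (1 + t)^-1 - 1/2.
Let dgl (t : R) := - ((1 - s) ^+ 2 / 2 * (1 - t) ^- 2).
Let dgr (t : R) := - ((1 + s) ^+ 2 / 2 * (1 + t) ^- 2).

Definition cap_profile (t : R) : R := if t <= s then gl t else gr t.
Definition dcap_profile (t : R) : R := if t <= s then dgl t else dgr t.

(** The branches agree to first order at [s], hence [cap_profile] is C^1. *)
Let glue0 : gl s = gr s.
Proof. by rewrite /gl /gr; field; rewrite !gt_eqF. Qed.

Let glue1 : dgl s = dgr s.
Proof. by rewrite /dgl /dgr; field; rewrite !gt_eqF. Qed.

Let gl_derive (t : R) : t <= s -> is_derive t 1 gl (dgl t).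
Proof.
move=> ts; have t0 : 1 - t != 0 by rewrite gt_eqF //; have := pl; lra.
have D0 : is_derive t 1 (fun u : R => 1 - u) (-1).
  by apply: (is_derive_eq (is_deriveB (is_derive_cst (1 : R) t 1)
    (is_derive_id t 1))); rewrite sub0r.
have D1 := @is_deriveV R (fun u => 1 - u) t (-1) 1 t0 D0.
have D2 := is_deriveB (is_derive_cst (1/2 : R) t 1)
  (is_deriveZ ((1 - s) ^+ 2 / 2) D1).
apply: (is_derive_eq D2).
rewrite sub0r /dgl; congr (- _).
change ((1 - s) ^+ 2 / 2 * (- (1 - t) ^- 2 * -1) = (1 - s) ^+ 2 / 2 * (1 - t) ^- 2).
by ring.
Qed.

Let gr_derive (t : R) : s <= t -> is_derive t 1 gr (dgr t).
Proof.
move=> ts; have t0 : 1 + t != 0 by rewrite gt_eqF //; have := pr; lra.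
have D0 : is_derive t 1 (fun u : R => 1 + u) 1.
  by apply: (is_derive_eq (is_deriveD (is_derive_cst (1 : R) t 1)
    (is_derive_id t 1))); rewrite add0r.
have D1 := @is_deriveV R (fun u => 1 + u) t 1 1 t0 D0.
have D2 := is_deriveB (is_deriveZ ((1 + s) ^+ 2 / 2) D1)
  (is_derive_cst (1/2 : R) t 1).
apply: (is_derive_eq D2).
rewrite subr0 /dgr.
change ((1 + s) ^+ 2 / 2 * (- (1 + t) ^- 2 * 1) = - ((1 + s) ^+ 2 / 2 * (1 +
  t) ^- 2)).
by ring.
Qed.

Lemma cap_profile_derive (t : R) : is_derive t 1 cap_profile (dcap_profile t).
Proof. exact: (is_derive_glue glue0 glue1 gl_derive gr_derive t). Qed.

Lemma dcap_profile_cont : continuous dcap_profile.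
Proof.
apply: (continuous_glue glue1) => t ts.
  have t0 : 1 - t != 0 by rewrite gt_eqF //; have := pl; lra.
  apply: continuousN; apply: continuousM; first exact: cst_continuous.
  apply: continuousV; first by rewrite expf_neq0.
  apply: (@continuous_comp _ _ _ (fun u : R => 1 - u) (fun v => v ^+ 2)).
    by apply: continuousB; [exact: cst_continuous|exact: cvg_id].
  exact: exprn_continuous.
have t0 : 1 + t != 0 by rewrite gt_eqF //; have := pr; lra.
apply: continuousN; apply: continuousM; first exact: cst_continuous.
apply: continuousV; first by rewrite expf_neq0.
apply: (@continuous_comp _ _ _ (fun u : R => 1 + u) (fun v => v ^+ 2)).
  by apply: continuousD; [exact: cst_continuous|exact: cvg_id].
exact: exprn_continuous.
Qed.

Lemma cap_profileE (t : R) :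
  `|t - s| = (1 + s ^+ 2) / 2 +
    ((1 - t ^+ 2) * dcap_profile t - 2 * t * cap_profile t).
Proof.
rewrite /cap_profile /dcap_profile; case: (leP t s) => ts.
  rewrite ler0_norm; last by lra.
  by rewrite /gl /dgl; field; rewrite gt_eqF //; have := pl; lra.
rewrite gtr0_norm; last by lra.
by rewrite /gr /dgr; field; rewrite gt_eqF //; have := pr; lra.
Qed.

(** A rate at which [cap_profile] decreases on [-1, 1]. *)
Definition cap_slope : R := (1 - `|s|) ^+ 2 / 8.

Lemma cap_slope_gt0 : 0 < cap_slope.
Proof. by rewrite divr_gt0 // exprn_gt0 // subr_gt0. Qed.

Let key (a b : R) : 0 <= a -> 0 < b -> b <= 2 -> a ^+ 2 / 8 <= a ^+ 2 / 2 * b ^- 2.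
Proof.
move=> a0 b0 b2; rewrite -mulrA ler_wpM2l ?sqr_ge0 //.
have -> : 8^-1 = 2^-1 * 4^-1 :> R by field.
rewrite ler_wpM2l // lef_pV2 ?posrE ?exprn_gt0 //.
have -> : 4 = 2 ^+ 2 :> R by ring.
by rewrite lerXn2r // nnegrE ltW.
Qed.

Lemma dcap_profile_le (t : R) : `|t| <= 1 -> dcap_profile t <= - cap_slope.
Proof.
rewrite ler_norml => /andP[t1 t2]; rewrite /dcap_profile /cap_slope.
have h0 : 0 <= 1 - `|s| by rewrite subr_ge0 ltW.
have hl := pl; have hr := pr.
case: (leP t s) => ts; rewrite lerN2.
  apply: le_trans (key (a := 1 - s) (b := 1 - t) _ _ _); try lra.
  have hs : 1 - `|s| <= 1 - s by rewrite lerD2l lerN2 ler_norm.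
  by rewrite ler_wpM2r // !expr2 ler_pM.
apply: le_trans (key (a := 1 + s) (b := 1 + t) _ _ _); try lra.
have hs : 1 - `|s| <= 1 + s by rewrite lerD2l lerNl -normrN ler_norm.
by rewrite ler_wpM2r // !expr2 ler_pM.
Qed.

Lemma cap_profile_decr (t : R) : `|t| <= 1 -> t * cap_profile t <=
  t * cap_profile 0 - cap_slope * t ^+ 2.
Proof.
move=> t1.
have [u ut E] := @MVT_theta R cap_profile dcap_profile t (fun u _ =>
  cap_profile_derive u).
have -> : cap_profile t = cap_profile 0 +
  dcap_profile u * t by rewrite -E addrC subrK.
rewrite mulrDr lerD2l mulrCA -expr2 -mulNr.
by rewrite ler_wpM2r ?sqr_ge0 // dcap_profile_le // (le_trans ut).
Qed.

End CapProfile.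

Section Zonal.
Context {R : realType} {n : nat}.
Variable L : ('rV[R]_n -> R) -> R.
Hypothesis HL : sphere_mean L.
Variable e : 'rV[R]_n.
Hypothesis e1 : enorm e = 1.

Definition linform (x : 'rV[R]_n) : R := \sum_i e 0 i * x 0 i.

Lemma C1_at_linform x : C1_at linform (fun i _ => e 0 i) x.
Proof.
have := @C1_at_sum R n n (fun k y => e 0 k * y 0 k)
  (fun k i y => 0 * y 0 k + e 0 k * (i == k)%:R) x
  (fun k => C1_at_mul (C1_at_cst (e 0 k) x) (C1_at_coord k x)).
apply: C1_at_ext => i y; rewrite (bigD1 i) //= big1 ?eqxx => [|k ki].
  by rewrite mul0r add0r mulr1 addr0.
by rewrite eq_sym (negbTE ki) mul0r mulr0 addr0.
Qed.

Lemma sphere_bounded_linform : sphere_bounded linform.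
Proof. by rewrite /linform; bnd. Qed.

(** The Cauchy-Schwarz inequality, from the squared length of the part of [x]
    orthogonal to [e]. *)
Lemma linform_le1 x : enorm x = 1 -> `|linform x| <= 1.
Proof.
move=> x1; have E := sphere_sqnorm x1; have Ee := sphere_sqnorm e1.
have : 0 <= \sum_i (x 0 i - linform x * e 0 i) ^+ 2.
  by apply: sumr_ge0 => i _; rewrite sqr_ge0.
have -> : \sum_i (x 0 i - linform x * e 0 i) ^+ 2 = 1 - linform x ^+ 2.
  have gen c : \sum_i (x 0 i - c * e 0 i) ^+ 2 =
      \sum_i x 0 i ^+ 2 - 2 * c * linform x + c ^+ 2 * \sum_i e 0 i ^+ 2.
    rewrite /linform !mulr_sumr -sumrB -big_split /=.
    by apply: eq_bigr => i _; ring.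
  by rewrite gen E Ee; ring.
rewrite subr_ge0 -[X in _ <= X -> _](expr1n _ 2) -(real_normK (num_real
  (linform x))).
by rewrite ler_pXn2r ?nnegrE.
Qed.

(** Integration by parts for functions of <e, x>: [mean_tangent] for g(<e, x>) in
    the direction [e]. *)
Lemma zonal_tangent (g dg : R -> R) : (forall t : R, is_derive t 1 g (dg t)) ->
  continuous dg ->
  L (fun x => (1 - linform x ^+ 2) * dg (linform x) - (n%:R - 1) *
    (linform x * g (linform x))) = 0.
Proof.
move=> Dg cdg.
have F : C1_sphere (fun x => g (linform x)) (fun i x => dg (linform x) * e 0 i).
  by move=> x x1; apply: C1_at_comp (C1_at_linform x) _ (cdg _).
have bg : sphere_bounded (fun x => g (linform x)) := C1_sphere_bnd F.
have bdg : sphere_bounded (fun x => dg (linform x)).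
  apply: sphere_bounded_cont => x _; apply: (@continuous_comp _ _ _ linform dg).
    exact: C1_at_cont (C1_at_linform x).
  exact: cdg.
have bl := sphere_bounded_linform.
have H k := mean_tangent HL k F.
have : \sum_k e 0 k * L (fun x => dg (linform x) * e 0 k - x 0 k *
     \sum_i x 0 i * (dg (linform x) * e 0 i)) =
   (n%:R - 1) * \sum_k e 0 k * L (fun x => x 0 k * g (linform x)).
  by rewrite mulr_sumr; apply: eq_bigr => k _; rewrite H mulrCA.
move=> /eqP; rewrite -subr_eq0 => /eqP E.
rewrite -[RHS]E mulr_sumr -sumrB.
transitivity (L (fun x => \sum_k (e 0 k * (dg (linform x) * e 0 k - x 0 k *
     \sum_i x 0 i * (dg (linform x) * e 0 i))
       - (n%:R - 1) * (e 0 k * (x 0 k * g (linform x)))))); last first.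
  rewrite (mean_sum HL) => [|k]; last by bnd.
  apply: eq_bigr => k _; rewrite (mean_sub HL); [|bnd|bnd].
  by rewrite !(mean_scale HL); bnd.
have bl2 : sphere_bounded (fun x =>
  linform x ^+ 2) by under eq_fun do rewrite expr2; bnd.
apply: (mean_eq HL); [bnd|bnd|] => x x1.
have -> : \sum_i x 0 i * (dg (linform x) * e 0 i) = linform x * dg (linform x).
  by rewrite mulr_suml; apply: eq_bigr => i _; ring.
transitivity ((\sum_k e 0 k ^+ 2) * dg (linform x)
   - linform x * (linform x * dg (linform x)) - (n%:R - 1) * (linform x * g
     (linform x))).
  by rewrite (sphere_sqnorm e1); ring.
rewrite {2 4}/linform !mulr_suml mulr_sumr -!sumrB.
by apply: eq_bigr => k _; ring.
Qed.

Hypothesis n3 : (3 <= n)%N.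

Lemma mean_linform : L linform = 0.
Proof.
have bl := sphere_bounded_linform.
have := @zonal_tangent (fun=> 1) (fun=> 0) (fun t => is_derive_cst (1 : R) t 1)
  (@cst_continuous R R 0).
have -> : (fun x => (1 - linform x ^+ 2) * 0 - (n%:R - 1) * (linform x * 1)) =
  (fun x => - (n%:R - 1) * linform x) by apply/funext => x; ring.
rewrite (mean_scale HL) // => /eqP; rewrite mulf_eq0 oppr_eq0 => /orP[|/eqP//].
by rewrite subr_eq0 -[1]/(1%:R) eqr_nat; case: n n3 => [|[|]].
Qed.

Lemma mean_linform_sq : L (fun x => linform x ^+ 2) = n%:R^-1.
Proof.
have bl := sphere_bounded_linform.
have bl2 : sphere_bounded (fun x =>
  linform x ^+ 2) by under eq_fun do rewrite expr2; bnd.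
have := @zonal_tangent id (fun=> 1) (fun t => is_derive_id t (1 : R))
  (@cst_continuous R R 1).
have -> : (fun x => (1 - linform x ^+ 2) * 1 - (n%:R - 1) *
  (linform x * linform x)) =
  (fun x => 1 - n%:R * linform x ^+ 2) by apply/funext => x; ring.
rewrite (mean_sub HL) ?(mean_scale HL) ?(mean_cst HL) //; bnd.
have n0 : n%:R != 0 :> R by rewrite pnatr_eq0; case: n n3.
by move=> /eqP; rewrite subr_eq0 => /eqP E; apply: (mulfI n0); rewrite -E mulfV.
Qed.

(** By [cap_profileE], |t - s| - (1 + s^2)/2 is the sum of
    (1 - t^2) g' - (n - 1) t g, whose mean is zero by [zonal_tangent], and of
    (n - 3) t g.  As g is decreasing and t has mean zero, t g has a negative mean,
    at most -cap_slope times the mean 1/n of t^2. *)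
Lemma mean_abs_linform (s : R) : `|s| < 1 ->
  L (fun x => `|linform x - s|) <= (1 + s ^+ 2) / 2 - (n%:R - 3) *
    (cap_slope s / n%:R).
Proof.
move=> s1; have bl := sphere_bounded_linform.
have F : C1_sphere (fun x => cap_profile s (linform x)) (fun i x =>
  dcap_profile s (linform x) * e 0 i).
  move=> x x1; apply: C1_at_comp (C1_at_linform x) _ (@dcap_profile_cont _ _ s1 _).
  exact: cap_profile_derive.
have bg : sphere_bounded (fun x => cap_profile s (linform x)) := C1_sphere_bnd F.
have bdg : sphere_bounded (fun x => dcap_profile s (linform x)).
  apply: sphere_bounded_cont => x _; apply: (@continuous_comp _ _ _ linform
    (dcap_profile s)).
    exact: C1_at_cont (C1_at_linform x).
  exact: dcap_profile_cont.
have bl2 : sphere_bounded (fun x =>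
  linform x ^+ 2) by under eq_fun do rewrite expr2; bnd.
have -> : (fun x => `|linform x - s|) = (fun x => (1 + s ^+ 2) / 2 +
    (((1 - linform x ^+ 2) * dcap_profile s (linform x) - (n%:R - 1) *
      (linform x * cap_profile s (linform x)))
     + (n%:R - 3) * (linform x * cap_profile s (linform x)))).
  by apply/funext => x; rewrite (cap_profileE s1); ring.
rewrite (mean_add HL); [|bnd|bnd].
rewrite (mean_cst HL) lerD2l (mean_add HL); [|bnd|bnd].
rewrite (zonal_tangent (cap_profile_derive s1) (dcap_profile_cont s1)).
rewrite add0r (mean_scale HL); last bnd.
rewrite -mulrN ler_wpM2l ?subr_ge0 ?ler_nat //.
apply: (@le_trans _ _ (L (fun x =>
  cap_profile s 0 * linform x - cap_slope s * linform x ^+ 2))).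
  apply: (mean_le HL); bnd => x /linform_le1 /(cap_profile_decr s1).
  by rewrite [_ * cap_profile s 0]mulrC.
rewrite (mean_sub HL); [|bnd|bnd].
rewrite !(mean_scale HL) //.
by rewrite mean_linform mean_linform_sq mulr0 sub0r.
Qed.

End Zonal.

(** * The differential equations for the moments of a solution *)
Section ODE.
Context {R : realType}.

Lemma is_derive_cont (f : R -> R) (x d : R) : is_derive x 1 f d ->
  {for x, continuous f}.
Proof.
by move=> [D _]; apply: differentiable_continuous; apply/derivable1_diffP.
Qed.

(** At the minimum over [0, r], a negative value of [u] would come with a
    positive derivative. *)
Lemma ode_nonneg (u du : R -> R) : u 0 = 0 ->
  (forall r : R, 0 <= r < 1 -> is_derive r 1 u (du r)) ->
  (forall r : R, 0 < r < 1 -> u r < 0 -> 0 < du r) ->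
  forall r : R, 0 <= r < 1 -> 0 <= u r.
Proof.
move=> u0 D H r /andP[r0 r1]; rewrite leNgt; apply/negP => ur.
have cu : {within `[0, r], continuous u}.
  apply: (@continuous_in_subspaceT R R `[0, r] u) => t /set_mem /=.
  rewrite in_itv /= => /andP[t0 tr]; apply: (is_derive_cont (D t _)).
  by rewrite t0 (le_lt_trans tr).
have [c cin cmin] := EVT_min r0 cu.
move: cin; rewrite in_itv /= => /andP[c0 cr].
have uc : u c < 0.
  by apply: le_lt_trans ur; apply: cmin; rewrite in_itv /= r0 lexx.
have c_gt0 : 0 < c.
  by rewrite lt_def c0 andbT; apply: contraTneq uc => ->; rewrite u0 ltxx.
have c1 : c < 1 := le_lt_trans cr r1.
have duc : 0 < du c by apply: H => //; rewrite c_gt0.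
have [D1 D2] := D c (introT andP (conj c0 c1)).
have cv : h^-1 *: ((u \o shift c) (h *: 1) - u c) @[h --> 0^'] --> du c.
  by rewrite -D2.
have /cvgrPdist_lt /(_ _ duc) /nbhs_ballP [d /= d0 Hd] := cv.
(* a point c - t of (0, c) where the difference quotient is close to du c *)
pose t := Num.min d c / 2.
have m0 : 0 < Num.min d c by rewrite lt_min d0.
have t0 : 0 < t by rewrite divr_gt0.
have td : t < d.
  have : Num.min d c <= d by rewrite ge_min lexx.
  by rewrite /t; lra.
have tc : t < c.
  have : Num.min d c <= c by rewrite ge_min lexx orbT.
  by rewrite /t; lra.
have := Hd (- t); rewrite /ball /= sub0r opprK gtr0_norm // => /(_ td).
rewrite oppr_eq0 gt_eqF // => /(_ isT).
rewrite [_%:A]mulr1.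
have um : u c <= u (- t + c).
  by apply: cmin; rewrite in_itv /=; apply/andP; split; lra.
have : (- t)^-1 *: (u (- t + c) - u c) <= 0.
  by rewrite invrN scaleNr oppr_le0 mulr_ge0 ?invr_ge0 ?(ltW t0) ?subr_ge0.
set q := _ *: _ => q0; rewrite ltr_norml => /andP[_]; lra.
Qed.

End ODE.

Section Estimate.
Context {R : realType} {n : nat}.
Hypothesis n3 : (3 <= n)%N.
Variable L : ('rV[R]_n -> R) -> R.
Hypothesis HL : sphere_mean L.

Lemma C1_at_scale (F : 'rV[R]_n -> R) dF (r : R) x : C1_at F dF (r *: x) ->
  C1_at (fun y => F (r *: y)) (fun i y => r * dF i (r *: y)) x.
Proof.
move=> HF.
have E (y : 'rV[R]_n) : (\row_k (r * y 0 k)) = r *: y by apply/rowP => k;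
  rewrite !mxE.
have := @C1_at_compv R n F dF (fun k y => r * y 0 k)
  (fun k i y => 0 * y 0 k + r * (i == k)%:R) x.
rewrite E => /(_ HF (fun k => C1_at_mul (C1_at_cst r x) (C1_at_coord k x))).
have -> : (fun y : 'rV[R]_n => F (\row_k (r * y 0 k))) = (fun y : 'rV[R]_n =>
  F (r *: y)).
  by apply/funext => y; rewrite E.
apply: C1_at_ext => i y; rewrite E (bigD1 i) //= big1 ?eqxx => [|k ki].
  by rewrite mul0r add0r mulr1 addr0.
by rewrite eq_sym (negbTE ki) mul0r mulr0 addr0 mul0r.
Qed.

Variables (h : 'rV[R]_n -> R) (dh : 'I_n -> 'rV[R]_n -> R)
  (ddh : 'I_n -> 'I_n -> 'rV[R]_n -> R) (eps : R).
Hypothesis H0 : forall x, enorm x < 1 -> C1_at h dh x.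
Hypothesis H1 : forall i x, enorm x < 1 -> C1_at (dh i) (ddh i) x.
Hypothesis eps0 : 0 <= eps.
Hypothesis eps1 : eps <= 1.
Hypothesis PDE : forall x, enorm x < 1 ->
  (1 - eps * sqnorm x) * \sum_i ddh i i x
   + 2 * eps * (n%:R - 2) * \sum_i x 0 i * dh i x = 0.

(** On the sphere of radius r: the radial derivative, the Laplacian and the
    second radial derivative of [h]. *)
Let rad (r : R) (x : 'rV[R]_n) := \sum_i x 0 i * dh i (r *: x).
Let lap (r : R) (x : 'rV[R]_n) := \sum_i ddh i i (r *: x).
Let hess (r : R) (x : 'rV[R]_n) := \sum_i x 0 i * \sum_k x 0 k * ddh i k (r *: x).

Section Fixed.
Variable r : R.
Hypothesis r1 : `|r| < 1.

Let bh : sphere_bounded (fun x => h (r *: x)) := sphere_bounded_scale H0 r1.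
Let bdh i : sphere_bounded (fun x => dh i (r *: x)) := sphere_bounded_scale
  (H1 i) r1.
Let bddh i k : sphere_bounded (fun x => ddh i k
  (r *: x)) := sphere_bounded_scaled k (H1 i) r1.
Let brad : sphere_bounded (rad r). Proof. by rewrite /rad; bnd; exact: bdh. Qed.
Let blap : sphere_bounded (lap r). Proof. by rewrite /lap; bnd; exact: bddh. Qed.
Let bhess : sphere_bounded (hess r). Proof. by rewrite /hess; bnd; exact: bddh. Qed.

Lemma mean_PDE (c : 'rV[R]_n -> R) : sphere_bounded c ->
  (1 - eps * r ^+ 2) * L (fun x => c x * lap r x)
  = - (2 * eps * (n%:R - 2) * r) * L (fun x => c x * rad r x).
Proof.
move=> bc; rewrite -!(mean_scale HL); [|bnd|bnd].
apply: (mean_eq HL); [bnd|bnd|] => x x1.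
have := PDE (scale_in_ball r1 x1).
rewrite sqnormZ -(enorm_sq x) x1 expr1n mulr1.
have -> : \sum_i (r *: x) 0 i * dh i (r *: x) = r * rad r x.
  by rewrite mulr_sumr; apply: eq_bigr => i _; rewrite mxE mulrA.
rewrite -/(lap r x) => E.
have -> : (1 - eps * r ^+ 2) * (c x * lap r x) =
  c x * ((1 - eps * r ^+ 2) * lap r x) by ring.
have -> : (1 - eps * r ^+ 2) * lap r x = - (2 * eps * (n%:R - 2) * (r * rad r x)).
  by apply/eqP; rewrite -subr_eq0 opprK E.
by ring.
Qed.

(** The Laplacian in polar coordinates, in weak form: [mean_tangent] for the
    components of c grad h, summed up. *)
Lemma mean_rad_tangent (c : 'rV[R]_n -> R) dc : C1_sphere c dc ->
  r * L (fun x => c x * lap r x) - r * L (fun x => c x * hess r x)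
  + L (fun x => \sum_i dc i x * dh i (r *: x))
  - L (fun x => (\sum_i x 0 i * dc i x) * rad r x)
  = (n%:R - 1) * L (fun x => c x * rad r x).
Proof.
move=> Hc; have bc := C1_sphere_bnd Hc; have bdc i := C1_sphere_bndd i Hc.
have F i : C1_sphere (fun x => c x * dh i (r *: x))
    (fun k x => dc k x * dh i (r *: x) + c x * (r * ddh i k (r *: x))).
  move=> x x1; apply: C1_at_mul (Hc x x1) _; apply: C1_at_scale.
  exact: H1 (scale_in_ball r1 x1).
have T i := mean_tangent HL i (F i).
have : \sum_i L (fun x => dc i x * dh i (r *: x) + c x * (r * ddh i i (r *: x))
   - x 0 i * \sum_k x 0 k * (dc k x * dh i (r *: x) + c x * (r * ddh i k (r *: x))))
  = \sum_i (n%:R - 1) * L (fun x => x 0 i * (c x * dh i (r *: x))).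
  by apply: eq_bigr => i _; exact: T.
rewrite -mulr_sumr -!(mean_sum HL); [|by move=> i; bnd; exact: bdh|
  by move=> i; bnd; first [exact: bdh|exact: bddh|exact: bdc]].
move=> E; transitivity ((n%:R - 1) * L (fun x => \sum_i x 0 i * (c x * dh i
  (r *: x)))).
  rewrite -E -!(mean_scale HL); [|bnd|bnd].
  rewrite -(mean_sub HL); [|bnd|bnd].
  rewrite -(mean_add HL); [|bnd|by bnd; first [exact: bdh|exact: bdc]].
  rewrite -(mean_sub HL); [|by bnd; first [exact: bdh|exact: bdc]|by bnd;
    exact: bdc].
  apply: (mean_eq HL); [by bnd; first [exact: bdh|exact: bdc]|
    by bnd; first [exact: bdh|exact: bddh|exact: bdc]|] => x x1.
  rewrite /lap /hess /rad !mulr_sumr -!sumrB -big_split /= -sumrB.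
  apply: eq_bigr => i _.
  have -> : \sum_k x 0 k * (dc k x * dh i (r *: x) + c x * (r * ddh i k (r *: x)))
    = (\sum_k x 0 k * dc k x) * dh i (r *: x)
       + c x * r * \sum_k x 0 k * ddh i k (r *: x).
    rewrite mulr_suml mulr_sumr -big_split /=.
    by apply: eq_bigr => k _; ring.
  by ring.
congr (_ * _); apply: (mean_eq HL); [by bnd; exact: bdh|bnd|] => x x1.
by rewrite /rad mulr_sumr; apply: eq_bigr => i _; ring.
Qed.

Lemma derive_mean_h (c : 'rV[R]_n -> R) : sphere_bounded c ->
  is_derive r 1 (fun s => L (fun x => c x * h (s *: x)))
    (L (fun x => c x * rad r x)).
Proof. by move=> bc; exact: (mean_radial HL bc H0 r1). Qed.

Lemma derive_mean_rad (c : 'rV[R]_n -> R) : sphere_bounded c ->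
  is_derive r 1 (fun s => L (fun x => c x * rad s x))
    (L (fun x => c x * hess r x)).
Proof.
move=> bc.
have -> : L (fun x => c x * hess r x) =
  \sum_i L (fun x => c x * x 0 i * \sum_k x 0 k * ddh i k (r *: x)).
  rewrite -(mean_sum HL); last by move=> i; bnd; exact: bddh.
  congr L; apply/funext => x; rewrite /hess mulr_sumr.
  by apply: eq_bigr => i _; rewrite mulrA.
have D i : is_derive r 1 (fun s => L (fun x => c x * x 0 i * dh i (s *: x)))
    (L (fun x => c x * x 0 i * \sum_k x 0 k * ddh i k (r *: x))).
  by apply: (mean_radial HL _ (H1 i) r1); bnd.
have := is_derive_sum D.
apply: near_eq_is_derive.
have [d d0 Hd] : exists2 d : R, 0 < d & forall s : R, `|r - s| < d -> `|s| < 1.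
  exists (1 - `|r|); first by rewrite subr_gt0.
  by move=> s; rewrite distrC => rs; have := ler_normD r (s - r);
    rewrite addrCA subrr addr0; lra.
apply/nbhs_normP; exists d => // s /= rs; rewrite fct_sumE.
have s1 := Hd s rs.
rewrite -(mean_sum HL); last by move=> i; bnd; exact: (sphere_bounded_scale
  (H1 i) s1).
congr L; apply/funext => x; rewrite /rad mulr_sumr.
by apply: eq_bigr => i _; rewrite mulrA.
Qed.

End Fixed.

Let nr : 3 <= n%:R :> R. Proof. by rewrite ler_nat. Qed.

Lemma mean_coord0 k : L (fun x => x 0 k) = 0.
Proof.
have := mean_tangent HL k (fun x _ => C1_at_cst 1 x).
have -> : (fun x : 'rV[R]_n => 0 - x 0 k * \sum_i x 0 i * 0) = (fun=> 0).
  by apply/funext => x; rewrite big1 ?mulr0 ?subr0 // => i _; rewrite mulr0.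
have -> : (fun x : 'rV[R]_n => x 0 k * 1) = (fun x => x 0 k).
  by apply/funext => x; rewrite mulr1.
rewrite (mean_cst HL) => /esym/eqP; rewrite mulf_eq0 => /orP[/eqP E|/eqP //].
by exfalso; have := nr; rewrite (subr0_eq E); lra.
Qed.

Lemma abs_lt1_itv (r : R) : 0 <= r < 1 -> `|r| < 1.
Proof. by move=> /andP[r0 r1]; rewrite ger0_norm. Qed.

Lemma one_sub_gt0 (r : R) : 0 <= r < 1 -> 0 < 1 - eps * r ^+ 2.
Proof.
move=> /andP[r0 r1]; rewrite subr_gt0.
by apply: (@le_lt_trans _ _ (r ^+ 2)); rewrite ?exprn_ilt1 // ler_piMl ?sqr_ge0.
Qed.

(** The mean M of the radial derivative satisfies
    (1 - eps r^2) r M' = - (positive) M and M(0) = 0, so that neither M nor -M can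
    become negative. *)
Lemma mean_radial_derivative0 (r : R) : 0 <= r < 1 -> L (fun x => 1 * rad r x) = 0.
Proof.
pose M (s : R) := L (fun x => 1 * rad s x).
pose dM (s : R) := L (fun x => 1 * hess s x).
have D (s : R) : 0 <= s < 1 -> is_derive s 1 M (dM s).
  by move=> /abs_lt1_itv s1; apply: derive_mean_rad; bnd.
have M0 : M 0 = 0.
  rewrite /M; transitivity (L (fun x => \sum_i dh i 0 * x 0 i)).
    congr L; apply/funext => x; rewrite mul1r; apply: eq_bigr => i _.
    by rewrite scale0r mulrC.
  rewrite (mean_sum HL) => [|i]; last by bnd.
  by rewrite big1 // => i _; rewrite (mean_scale HL) ?mean_coord0 ?mulr0 //; bnd.
have rel (s : R) : 0 <= s < 1 -> (1 - eps * s ^+ 2) * (s * dM s) =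
   - (2 * eps * (n%:R - 2) * s ^+ 2 + (1 - eps * s ^+ 2) * (n%:R - 1)) * M s.
  move=> /abs_lt1_itv s1.
  have T := mean_rad_tangent s1 (fun x _ => C1_at_cst 1 x).
  have Q : (1 - eps * s ^+ 2) * L (fun x => 1 * lap s x)
     = - (2 * eps * (n%:R - 2) * s) * M s by apply: mean_PDE => //; bnd.
  move: T; rewrite -/(M s) -/(dM s).
  have -> : (fun x : 'rV[R]_n => \sum_i 0 * dh i (s *: x)) = (fun=> 0).
    by apply/funext => x; rewrite big1 // => i _; rewrite mul0r.
  have -> : (fun x : 'rV[R]_n => (\sum_i x 0 i * 0) * rad s x) = (fun=> 0).
    by apply/funext => x; rewrite big1 ?mul0r // => i _; rewrite mulr0.
  rewrite (mean_cst HL) addr0 subr0 => T.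
  have -> : s * dM s = s * L (fun x => 1 * lap s x) - (n%:R - 1) * M s.
    by rewrite -T; ring.
  by rewrite mulrBr mulrCA Q; ring.
have coef (s : R) : 0 <= s < 1 ->
    0 < 2 * eps * (n%:R - 2) * s ^+ 2 + (1 - eps * s ^+ 2) * (n%:R - 1).
  move=> s1; have p0 := one_sub_gt0 s1; have := nr => n3'.
  apply: ltr_wpDl; first by rewrite !mulr_ge0 ?sqr_ge0 //; lra.
  by rewrite mulr_gt0 //; lra.
have sgn (u : R) (s : R) : 0 < s < 1 -> u * M s < 0 -> 0 < u * dM s.
  move=> /andP[s0 s1] uM; have s01 : 0 <= s < 1 by rewrite ltW.
  have p0 := one_sub_gt0 s01; have c0 := coef s s01.
  have : 0 < (1 - eps * s ^+ 2) * (s * (u * dM s)).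
    have -> : (1 - eps * s ^+ 2) * (s * (u * dM s)) =
       u * ((1 - eps * s ^+ 2) * (s * dM s)) by ring.
    by rewrite (rel s s01) mulrCA mulNr -mulrN mulr_gt0 // oppr_gt0.
  by rewrite (pmulr_rgt0 _ p0) (pmulr_rgt0 _ s0).
move=> r01; apply/eqP; rewrite eq_le; apply/andP; split; last first.
  apply: (@ode_nonneg R M dM) => // s s01 Ms.
  by have := sgn 1 s s01; rewrite !mul1r; apply.
rewrite -oppr_ge0.
apply: (@ode_nonneg R (fun s => - M s) (fun s => - dM s)) => //.
- by rewrite M0 oppr0.
- by move=> s s01; have Ds := D s s01; exact: is_deriveN.
- by move=> s s01 Ms; have := sgn (-1) s s01; rewrite !mulN1r; apply.
Qed.

Lemma mean_value (r : R) : 0 <= r < 1 -> L (fun x => 1 * h (r *: x)) = h 0.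
Proof.
move=> r01; pose A (s : R) := L (fun x => 1 * h (s *: x)).
have A0 : A 0 = h 0.
  rewrite /A -[RHS](mean_cst HL); congr L.
  by apply/funext => x; rewrite mul1r scale0r.
have D (s : R) : 0 <= s < 1 -> is_derive s 1 A 0.
  move=> s01; rewrite -(mean_radial_derivative0 s01).
  by apply: derive_mean_h; [exact: abs_lt1_itv|bnd].
have [r0 r1] := andP r01.
have [s||s _ E] := @MVT_segment R A (fun=> 0) 0 r r0.
- by rewrite in_itv /= => /andP[s0 sr]; apply: D; rewrite ltW // (lt_trans sr).
- apply: (@continuous_in_subspaceT R R `[0, r] A) => t /set_mem /=.
  rewrite in_itv /= => /andP[t0 tr]; apply: (is_derive_cont (D t _)).
  by rewrite t0 (le_lt_trans tr).
by move/eqP: E; rewrite mul0r A0 subr_eq0 => /eqP.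
Qed.

Section Direction.
Variable e : 'rV[R]_n.
Hypothesis e1 : enorm e = 1.

Let l := linform e.
(** [Q] is the derivative of the first moment [B], and [Q1] that of [Q]; [E] is the
    mean over the sphere of radius r of the derivative of [h] along the field
    (1 + eps |x|^2) e - 2 eps <e, x> x. *)
Let P (r : R) := L (fun x => \sum_i e 0 i * dh i (r *: x)).
Let Q (r : R) := L (fun x => l x * rad r x).
Let Q1 (r : R) := L (fun x => l x * hess r x).
Let B (r : R) := L (fun x => l x * h (r *: x)).
Let E (r : R) := (1 + eps * r ^+ 2) * P r - 2 * eps * r ^+ 2 * Q r.
Let k := \sum_i e 0 i * dh i 0.

Let bl : sphere_bounded l := sphere_bounded_linform e.

Lemma first_moment_tangent (r : R) : `|r| < 1 -> (n%:R - 1) * B r = r * (P r - Q r).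
Proof.
move=> r1; have bdh i := sphere_bounded_scale (H1 i) r1;
  have bh := sphere_bounded_scale H0 r1.
have F : C1_sphere (fun x => h (r *: x)) (fun i x => r * dh i (r *: x)).
  by move=> x x1; apply: C1_at_scale; exact: H0 (scale_in_ball r1 x1).
have T j := mean_tangent HL j F.
have : \sum_j e 0 j * L (fun x => r * dh j (r *: x)
     - x 0 j * \sum_i x 0 i * (r * dh i (r *: x)))
  = (n%:R - 1) * \sum_j e 0 j * L (fun x => x 0 j * h (r *: x)).
  by rewrite mulr_sumr; apply: eq_bigr => j _; rewrite T mulrCA.
have -> : \sum_j e 0 j * L (fun x => x 0 j * h (r *: x)) = B r.
  transitivity (L (fun x => \sum_j e 0 j * (x 0 j * h (r *: x)))).
    rewrite (mean_sum HL) => [|j]; last by bnd.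
    by apply: eq_bigr => j _; rewrite (mean_scale HL) //; bnd.
  congr L; apply/funext => x; rewrite /l /linform mulr_suml.
  by apply: eq_bigr => j _; rewrite mulrA.
move=> <-; rewrite /P /Q.
rewrite -(mean_sub HL); [|by bnd; exact: bdh|by rewrite /rad; bnd; exact: bdh].
rewrite -(mean_scale HL); last by rewrite /rad; bnd; exact: bdh.
transitivity (L (fun x => \sum_j e 0 j * (r * dh j (r *: x)
     - x 0 j * \sum_i x 0 i * (r * dh i (r *: x))))).
  rewrite (mean_sum HL) => [|j]; last by bnd; exact: bdh.
  by apply: eq_bigr => j _; rewrite (mean_scale HL) //; bnd; exact: bdh.
congr L; apply/funext => x.
have -> : \sum_i x 0 i * (r * dh i (r *: x)) = r * rad r x.
  by rewrite mulr_sumr; apply: eq_bigr => i _; ring.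
move: (rad r x) => g; rewrite /l /linform mulr_suml -sumrB mulr_sumr.
by apply: eq_bigr => j _; ring.
Qed.

(** For r > 0, [first_moment_tangent] expresses [E] by [B] and its derivative [Q],
    as (1 - eps r^2) Q + (n - 1) (1/r + eps r) B.  In the derivative of this
    expression only [Q] is differentiated again, and its derivative [Q1] is
    determined by [mean_rad_tangent] and the equation for [h]. *)
Lemma killing_mean_derive (r : R) : 0 < r < 1 -> is_derive r 1 E 0.
Proof.
move=> /andP[r0 r1]; have r01 : 0 <= r < 1 by rewrite ltW.
have ra := abs_lt1_itv r01; have rn0 : r != 0 by rewrite gt_eqF.
have DB : is_derive r 1 B (Q r) by apply: derive_mean_h.
have DQ : is_derive r 1 Q (Q1 r) by apply: derive_mean_rad.
have DX : is_derive r 1 (fun s : R => s ^+ 2) (2 * r).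
  apply: DeriveDef; first exact: exprn_derivable.
  by rewrite -derive1E exp_derive1 expr1.
have DV : is_derive r 1 (fun s : R => s^-1) (- r ^- 2).
  have := @is_deriveV R id r 1 1 rn0 (is_derive_id r (1 : R)).
  by move=> DV; apply: (is_derive_eq DV); exact: mulr1.
have Dp : is_derive r 1 (fun s : R => 1 - eps * s ^+ 2) (- (eps * (2 * r))).
  have := is_deriveB (is_derive_cst (1 : R) r 1) (is_deriveZ eps DX).
  by move=> Dp; apply: (is_derive_eq Dp); rewrite sub0r.
have Dq : is_derive r 1 (fun s : R => s^-1 + eps * s) (- r ^- 2 + eps).
  have := is_deriveD DV (is_deriveZ eps (is_derive_id r (1 : R))).
  by move=> Dq; apply: (is_derive_eq Dq); congr (_ + _); exact: mulr1.
have DpQ := is_deriveM Dp DQ.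
have DqB := is_deriveZ (n%:R - 1) (is_deriveM Dq DB).
have DE := is_deriveD DpQ DqB.
have DE2 : is_derive r 1 (fun s => (1 - eps * s ^+ 2) * Q s
    + (n%:R - 1) * ((s^-1 + eps * s) * B s)) 0.
  apply: (is_derive_eq DE).
  change ((1 - eps * r ^+ 2) * Q1 r + Q r * (- (eps * (2 * r))) +
     (n%:R - 1) * ((r^-1 + eps * r) * Q r + B r * (- r ^- 2 + eps)) = 0).
  have T := mean_rad_tangent ra (fun x _ => C1_at_linform e x).
  have PD : (1 - eps * r ^+ 2) * L (fun x => l x * lap r x)
     = - (2 * eps * (n%:R - 2) * r) * Q r by apply: mean_PDE.
  move: T; rewrite -/(Q1 r) -/(P r).
  have -> : (fun x : 'rV[R]_n => (\sum_i x 0 i * e 0 i) * rad r x) =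
      (fun x => l x * rad r x).
    apply/funext => x; congr (_ * _); apply: eq_bigr => i _; exact: mulrC.
  rewrite -/(Q r) => T.
  have BT := first_moment_tangent ra.
  apply: (mulfI rn0); rewrite mulr0.
  have Q1E : r * Q1 r = r * L (fun x => l x * lap r x) + (P r - Q r) -
    (n%:R - 1) * Q r.
    by rewrite -T; ring.
  have BE : (n%:R - 1) * B r * r^-1 = P r - Q r by rewrite BT mulrAC mulfV // mul1r.
  transitivity ((1 - eps * r ^+ 2) * (r * Q1 r) - 2 * eps * r ^+ 2 * Q r
     + (n%:R - 1) * (1 + eps * r ^+ 2) * Q r
     - (1 - eps * r ^+ 2) * ((n%:R - 1) * B r * r^-1)).
    by field.
  rewrite BE Q1E.
  transitivity (r * ((1 - eps * r ^+ 2) * L (fun x => l x * lap r x))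
    + 2 * eps * (n%:R - 2) * r ^+ 2 * Q r); first by ring.
  by rewrite PD; ring.
apply: near_eq_is_derive DE2.
near=> s.
have s0 : 0 < s by near: s; exact: lt_nbhsr.
have s1 : s < 1 by near: s; exact: lt_nbhsl.
have sa : `|s| < 1 by apply: abs_lt1_itv; rewrite ltW.
have BT := first_moment_tangent sa.
have -> : (n%:R - 1) * ((s^-1 + eps * s) * B s)
   = (s^-1 + eps * s) * ((n%:R - 1) * B s) by ring.
by rewrite BT /E; field; rewrite gt_eqF.
Unshelve. all: by end_near. Qed.

Lemma killing_mean_continuous (r : R) : `|r| < 1 -> {for r, continuous E}.
Proof.
move=> r1.
have cQ : {for r, continuous Q}.
  have DQ : is_derive r 1 Q (Q1 r) by apply: derive_mean_rad.
  exact: is_derive_cont DQ.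
have D i : is_derive r 1 (fun s => L (fun x => e 0 i * dh i (s *: x)))
    (L (fun x => e 0 i * \sum_j x 0 j * ddh i j (r *: x))).
  by apply: (mean_radial HL _ (H1 i) r1); bnd.
have DP : is_derive r 1 P
    (\sum_i (L (fun x => e 0 i * \sum_j x 0 j * ddh i j (r *: x)))).
  have := is_derive_sum D.
  apply: near_eq_is_derive.
  have d0 : 0 < 1 - `|r| by rewrite subr_gt0.
  apply/nbhs_normP; exists (1 - `|r|) => // s /= rs; rewrite fct_sumE.
  have s1 : `|s| < 1.
    by have := ler_normD r (s - r); rewrite distrC in rs;
      rewrite addrCA subrr addr0; lra.
  by rewrite -(mean_sum HL) // => i; bnd; exact: (sphere_bounded_scale (H1 i) s1).
have cP := is_derive_cont DP.
have cX : {for r, continuous (fun s : R => s ^+ 2)} by exact: exprn_continuous.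
have cc (a : R) : {for r, continuous (fun=> a : R)} by exact: cst_continuous.
apply: continuousB; apply: continuousM => //.
  by apply: continuousD => //; apply: continuousM.
by apply: continuousM.
Qed.

Lemma killing_mean_const (r : R) : 0 <= r < 1 -> E r = k.
Proof.
move=> /andP[r0 r1].
have E0 : E 0 = k.
  rewrite /E expr0n /= !mulr0 mul0r addr0 mul1r subr0 /P -[RHS](mean_cst HL).
  congr L; apply/funext => x; apply: eq_bigr => i _; by rewrite scale0r.
have [s||s _ Es] := @MVT_segment R E (fun=> 0) 0 r r0.
- rewrite in_itv /= => /andP[s0 sr]; apply: killing_mean_derive.
  by rewrite s0 (lt_trans sr).
- apply: (@continuous_in_subspaceT R R `[0, r] E) => t /set_mem /=.
  rewrite in_itv /= => /andP[t0 tr]; apply: killing_mean_continuous;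
    apply: abs_lt1_itv.
  by rewrite t0 (le_lt_trans tr).
by move/eqP: Es; rewrite mul0r E0 subr_eq0 => /eqP.
Qed.

Let m : R := n%:R + eps * (n%:R - 2).

Lemma rate_gt0 : 0 < m.
Proof.
have h3 := nr; apply: ltr_wpDr; last by lra.
by rewrite mulr_ge0 //; lra.
Qed.

(** The equation E = k reads
    r (1 - eps r^2) B' + (n - 1)(1 + eps r^2) B = k r, and (k / m) r is a
    subsolution of it for this choice of [m], with equality at r = 1. *)
Lemma first_moment_lower (r : R) : 0 <= k -> 0 <= r < 1 -> k / m * r <= B r.
Proof.
move=> k0 r01; have m0 := rate_gt0; have h3 := nr.
rewrite -subr_ge0.
apply: (@ode_nonneg R (fun s => B s - k / m * s) (fun s => Q s - k / m)) r01.
- rewrite mulr0 subr0 /B.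
  transitivity (L (fun x => h 0 * l x)).
    by congr L; apply/funext => x; rewrite scale0r mulrC.
  by rewrite (mean_scale HL) // (mean_linform HL e1 n3) mulr0.
- move=> s s01.
  have DB : is_derive s 1 B (Q s) by apply: derive_mean_h; rewrite ?abs_lt1_itv.
  have := is_deriveB DB (is_deriveZ (k / m) (is_derive_id s (1 : R))).
  by move=> D; apply: (is_derive_eq D); congr (_ - _); exact: mulr1.
move=> s /andP[s0 s1] us; have s01 : 0 <= s < 1 by rewrite ltW.
have p0 := one_sub_gt0 s01; have BT := first_moment_tangent (abs_lt1_itv s01);
  have Ek := killing_mean_const s01.
have key : s * (1 - eps * s ^+ 2) * Q s + (n%:R - 1) * (1 + eps * s ^+ 2) * B s
   = k * s.
  rewrite -Ek /E.
  have -> : (n%:R - 1) * (1 + eps * s ^+ 2) * B s =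
     (1 + eps * s ^+ 2) * ((n%:R - 1) * B s) by ring.
  by rewrite BT; ring.
have kE : k = k / m * m by rewrite divfK // gt_eqF.
have k'0 : 0 <= k / m by rewrite divr_ge0 // ltW.
move: key kE k'0 us; move: (k / m) => k' key kE k'0 us.
have q0 : 0 < (n%:R - 1) * (1 + eps * s ^+ 2).
  apply: mulr_gt0; first by lra.
  by rewrite ltr_wpDr // mulr_ge0 // sqr_ge0.
have s2 : s ^+ 2 <= 1 by rewrite exprn_ile1 // ltW.
have W : 0 <= k' * s * (eps * (n%:R - 2) * (1 - s ^+ 2)).
  by rewrite !mulr_ge0 ?(ltW s0) // ?subr_ge0 //; lra.
have : 0 < s * (1 - eps * s ^+ 2) * (Q s - k').
  have -> : s * (1 - eps * s ^+ 2) * (Q s - k') =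
    k' * s * (eps * (n%:R - 2) * (1 - s ^+ 2))
    - (n%:R - 1) * (1 + eps * s ^+ 2) * (B s - k' * s).
    have -> : s * (1 - eps * s ^+ 2) * (Q s - k') =
      s * (1 - eps * s ^+ 2) * Q s - s * (1 - eps * s ^+ 2) * k' by ring.
    have -> : s * (1 - eps * s ^+ 2) * Q s =
      k * s - (n%:R - 1) * (1 + eps * s ^+ 2) * B s by rewrite -key; ring.
    by rewrite kE /m; ring.
  apply: ltr_wpDl => //; rewrite oppr_gt0.
  by rewrite pmulr_rlt0.
by rewrite pmulr_rgt0 // mulr_gt0.
Qed.

Hypothesis hb : forall x, enorm x < 1 -> `|h x| < 1.

(** With s = - h(0), the mean of (l - s) h(rx) is B(r) + h(0)^2, and it is at most
    the mean of |l - s|; then r tends to 1. *)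
Theorem direction_bound : 0 <= k ->
  k <= m * ((1 - h 0 ^+ 2) / 2 - (n%:R - 3) * (cap_slope (- h 0) / n%:R)).
Proof.
move=> k0; set C := m * _; have m0 := rate_gt0.
have a1 : `|h 0| < 1.
  by apply: hb; rewrite /enorm big1 ?sqrtr0 // => i _; rewrite mxE expr0n.
have main (r : R) : 0 <= r < 1 -> k * r <= C.
  move=> r01; have r1 := abs_lt1_itv r01.
  have bh := sphere_bounded_scale H0 r1.
  have := first_moment_lower k0 r01; rewrite mulrAC ler_pdivrMr // =>
    /le_trans; apply.
  rewrite mulrC /C ler_wpM2l ?(ltW m0) //.
  have := mean_value r01.
  have sa : `|- h 0| < 1 by rewrite normrN.
  have := mean_abs_linform HL e1 n3 sa; rewrite sqrrN => up A0.
  have babs : sphere_bounded (fun x => `|linform e x - - h 0|).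
    apply: sphere_bounded_cont => x x1; apply: continuous_comp;
      last exact: norm_continuous.
    apply: continuousB; last exact: cst_continuous.
    exact: C1_at_cont (C1_at_linform e x).
  have : L (fun x => (l x - - h 0) * h (r *: x)) <= L (fun x =>
    `|linform e x - - h 0|).
    apply: (mean_le HL); [bnd|bnd|] => x x1.
    apply: le_trans (ler_norm _) _; rewrite normrM ler_piMr //.
    by apply/ltW/hb; exact: scale_in_ball.
  have -> : (fun x => (l x - - h 0) * h (r *: x)) =
    (fun x => l x * h (r *: x) + h 0 * (1 * h (r *: x))).
    by apply/funext => x; ring.
  rewrite (mean_add HL); [|bnd|bnd].
  rewrite (mean_scale HL); last bnd.
  rewrite A0 -/(B r) => up2.
  have -> : (1 - h 0 ^+ 2) / 2 = (1 + h 0 ^+ 2) / 2 - h 0 * h 0 by field.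
  lra.
rewrite leNgt; apply/negP => Ck.
have C0 : 0 <= C by have := main 0; rewrite lexx ltr01 mulr0; exact.
have kp : 0 < k by apply: le_lt_trans Ck.
(* the radius halfway between C / k and 1 *)
have := main ((C / k + 1) / 2).
have q1 : C / k < 1 by rewrite ltr_pdivrMr // mul1r.
have q0 : 0 <= C / k by rewrite divr_ge0.
have -> : k * ((C / k + 1) / 2) = (C + k) / 2 by field; rewrite gt_eqF.
have -> : 0 <= (C / k + 1) / 2 < 1 by apply/andP; split; lra.
by move=> /(_ isT); lra.
Qed.

End Direction.
End Estimate.

(** * Solutions of the two equations *)
Section Harmonic.
Context {R : realType} {n : nat}.
Implicit Types (x y : 'rV[R]_n) (u : 'rV[R]_n -> R).
Notation U := (@unit_ball R n).

Lemma near_unit_ball x : U x -> \forall y \near x, U y.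
Proof.
move=> xU; have c : enorm y @[y --> x] --> enorm x := @enorm_cont R n x.
exact: (c _ (lt_nbhsl xU)).
Qed.

Lemma class_C1_C1_at u : class_C 1 U u -> forall x, U x ->
  C1_at u (fun i => partial i u) x.
Proof.
move=> [_ H] x xU; apply: partials_C1_at => [|i]; last exact: (H i).2.1.
apply: filterS (near_unit_ball xU) => y yU i.
by apply: derivableP; exact: (H i).1.
Qed.

Lemma class_C2_C1_at u : class_C 2 U u -> forall x, U x ->
  C1_at u (fun i => partial i u) x /\
  forall i, C1_at (partial i u) (fun k => partial k (partial i u)) x.
Proof.
move=> [cu H] x xU; split=> [|i]; last exact: class_C1_C1_at (H i).2 _ xU.
apply: class_C1_C1_at => //; split=> // i; split; first exact: (H i).1.
by split=> //; exact: (H i).2.1.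
Qed.

(** Functions of class C^2 are produced from formulas for the first and second
    partial derivatives. *)
Lemma C1_at_class_C2 u du ddu : (forall x, U x -> C1_at u du x) ->
  (forall i x, U x -> C1_at (du i) (ddu i) x) ->
  class_C 2 U u /\ forall x, U x -> forall i, partial i u x = du i x /\
    forall k, partial k (partial i u) x = ddu i k x.
Proof.
move=> H1 H2.
have E1 x i : U x -> partial i u x = du i x by move=> /H1 [_ /(_ i) []].
have H3 i x : U x -> C1_at (partial i u) (ddu i) x.
  move=> xU; apply: C1_at_near (H2 i x xU).
  by apply: filterS (near_unit_ball xU) => y yU; rewrite E1.
have E2 i k x : U x -> partial k (partial i u) x = ddu i k x.
  by move=> /(H3 i) [_ /(_ k) []].
split; last by move=> x xU i; split=> [|k]; [exact: E1|exact: E2].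
split=> [x /H1|i]; first exact: C1_at_cont.
split=> [x /H1 [d _]|]; first exact: diff_derivable.
split=> [x /(H3 i)|k]; first exact: C1_at_cont.
split=> [x /(H3 i) [d _]|]; first exact: diff_derivable.
split=> // x xU; have H : C1_at (partial i u) (fun j => partial j (partial i u)) x.
  apply: C1_at_near (H3 i x xU).
  by apply: filterS (near_unit_ball xU) => y yU; split=> // j; rewrite E2.
by have [_ /(_ k) []] := H.
Qed.

(** The family of equations which contains the two cases; for eps = 1 the equation
    is the hyperbolic one divided by 1 - |x|^2. *)
Definition eps_harmonic (eps : R) u := class_C 2 U u /\
  forall x, U x -> (1 - eps * sqnorm x) * laplacian u x
    + 2 * eps * (n%:R - 2) * \sum_i x 0 i * partial i u x = 0.

Lemma harmonic_eps u : harmonic_on_ball u <-> eps_harmonic 0 u.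
Proof.
split=> -[c H]; split=> // x /H; rewrite mul0r subr0 mul1r mulr0 !mul0r addr0 //.
Qed.

Lemma hyp_harmonic_eps u : hyp_harmonic_on_ball u <-> eps_harmonic 1 u.
Proof.
have E x : hyp_laplacian u x = (1 - sqnorm x) * ((1 - 1 * sqnorm x) * laplacian u x
    + 2 * 1 * (n%:R - 2) * \sum_i x 0 i * partial i u x).
  by rewrite /hyp_laplacian enorm_sq; ring.
split=> -[c H]; split=> // x xU; last by rewrite E H // mulr0.
have := H x xU; rewrite E => /eqP; rewrite mulf_eq0 => /orP[|/eqP//].
rewrite subr_eq0 eq_sym lt_eqF // -enorm_sq exprn_ilt1 //.
exact: sqrtr_ge0.
Qed.

Lemma C1_at_eq u du (v : 'rV[R]_n -> R) dv x : (forall y, u y = v y) ->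
  (forall i y, du i y = dv i y) -> C1_at u du x -> C1_at v dv x.
Proof. by move=> /funext -> E; exact: C1_at_ext. Qed.

Lemma zero_in_ball : U 0.
Proof. by rewrite /unit_ball /= /enorm big1 ?sqrtr0 // => i _;
  rewrite mxE expr0n. Qed.

(** The function h = -1 + u/B takes its values in (-1, 0], and
    1 - h(0)^2 = (u(0)/B)(2 - u(0)/B) <= 2 u(0)/B. *)
Lemma sharp_from_positive (eps c B : R) u du ddu :
  (forall x, U x -> C1_at u du x) ->
  (forall i x, U x -> C1_at (du i) (ddu i) x) ->
  (forall x, U x -> (1 - eps * sqnorm x) * \sum_i ddu i i x
    + 2 * eps * (n%:R - 2) * \sum_i x 0 i * du i x = 0) ->
  (forall x, U x -> 0 < u x <= B) ->
  (forall h, ball_to_pm1 h -> eps_harmonic eps h ->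
     enorm (grad h 0) <= c * (1 - `|h 0| ^+ 2)) ->
  forall i, du i 0 <= 2 * c * u 0.
Proof.
move=> H1 H2 HP Hu Hc i.
have /andP[u0 uB] := Hu 0 zero_in_ball.
have B0 : 0 < B by exact: lt_le_trans uB.
pose h x := B^-1 * u x + -1.
pose dh i x := B^-1 * du i x.
pose ddh i k x := B^-1 * ddu i k x.
have h1 x : U x -> C1_at h dh x.
  move=> /H1 C; apply: C1_at_eq (C1_at_add (C1_at_mul (C1_at_cst B^-1 x) C)
    (C1_at_cst (-1) x)) => //.
  by move=> j y; rewrite /dh; ring.
have h2 j x : U x -> C1_at (dh j) (ddh j) x.
  move=> /(H2 j) C; apply: C1_at_eq (C1_at_mul (C1_at_cst B^-1 x) C) => //.
  by move=> k y; rewrite /ddh; ring.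
have [hC hE] := C1_at_class_C2 h1 h2.
have hh : eps_harmonic eps h.
  split=> // x xU; rewrite /laplacian.
  have -> : \sum_j partial j (partial j h) x = B^-1 * \sum_j ddu j j x.
    by rewrite mulr_sumr; apply: eq_bigr => j _; rewrite (hE x xU j).2.
  have -> : \sum_j x 0 j * partial j h x = B^-1 * \sum_j x 0 j * du j x.
    by rewrite mulr_sumr; apply: eq_bigr => j _; rewrite (hE x xU j).1 mulrCA.
  by rewrite mulrCA [X in _ + X]mulrCA -mulrDr HP // mulr0.
have hb : ball_to_pm1 h.
  move=> x /Hu /andP[ux xB].
  have a1 : 0 < B^-1 * u x by rewrite mulr_gt0 ?invr_gt0.
  have a2 : B^-1 * u x <= 1 by rewrite mulrC ler_pdivrMr // mul1r.
  by rewrite /h; apply/andP; split; lra.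
have key := Hc h hb hh.
have v0 : 0 < B^-1 * u 0 by rewrite mulr_gt0 ?invr_gt0.
have v1 : B^-1 * u 0 <= 1 by rewrite mulrC ler_pdivrMr // mul1r.
have hE0 : 1 - `|h 0| ^+ 2 = B^-1 * u 0 * (2 - B^-1 * u 0).
  by rewrite real_normK ?num_real // /h; ring.
have c0 : 0 <= c.
  have : 0 <= c * (1 - `|h 0| ^+ 2) by apply: le_trans key; exact: sqrtr_ge0.
  by rewrite hE0 pmulr_lge0 // mulr_gt0 //; lra.
have : dh i 0 <= c * (1 - `|h 0| ^+ 2).
  apply: le_trans key; apply: le_trans (coord_le_enorm _ i).
  rewrite mxE (hE 0 zero_in_ball i).1; exact: ler_norm.
rewrite hE0 /dh => k1.
have k2 : B^-1 * du i 0 <= B^-1 * (2 * c * u 0).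
  apply: le_trans k1 _.
  have -> : B^-1 * (2 * c * u 0) = c * (B^-1 * u 0 * 2) by ring.
  by rewrite ler_wpM2l // ler_pM2l //; lra.
by rewrite -(ler_pM2l (x := B^-1)) ?invr_gt0.
Qed.

Lemma C1_at_exp (f : 'rV[R]_n -> R) df m x : C1_at f df x ->
  C1_at (fun y => f y ^+ m) (fun i y => m%:R * f y ^+ m.-1 * df i y) x.
Proof.
move=> F; have D (t : R) : is_derive t 1 (fun s : R => s ^+ m) (m%:R * t ^+ m.-1).
  apply: DeriveDef; first exact: exprn_derivable.
  by rewrite -derive1E exp_derive1.
apply: (@C1_at_comp R n (fun s => s ^+ m) (fun s => m%:R * s ^+ m.-1)) => //.
by apply: continuousM; [exact: cst_continuous|exact: exprn_continuous].
Qed.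

End Harmonic.

(** * Sharpness for harmonic functions: a Poisson kernel *)

Section Poisson.
Context {R : realType} {n' : nat}.
Notation n := n'.+3.
Variable t : R.
Hypothesis t1 : 1 < t.
Notation U := (@unit_ball R n).
Implicit Types x y : 'rV[R]_n.

(** The pole is the point t e_0, [z] is the vector from the pole and [q] the square
    of its length.  The function [u] is (t^2 - |x|^2)/|x - t e_0|^n; [du] and [ddu]
    are its partial derivatives. *)
Let q y := sqnorm y - 2 * t * y 0 ord0 + t ^+ 2.
Let z i y := y 0 i - t * (i == ord0)%:R.
Let sg y := (Num.sqrt (q y))^-1.
Let tau y := t ^+ 2 - sqnorm y.

Let u y := tau y * sg y ^+ n.
Let du i y := - 2 * y 0 i * sg y ^+ n - n%:R * tau y * z i y * sg y ^+ n.+2.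
Let ddu i k y := - 2 * (k == i)%:R * sg y ^+ n +
  2 * n%:R * y 0 i * z k y * sg y ^+ n.+2
   + 2 * n%:R * y 0 k * z i y * sg y ^+ n.+2
   - n%:R * tau y * (k == i)%:R * sg y ^+ n.+2
   + n%:R * (n.+2)%:R * tau y * z i y * z k y * sg y ^+ n.+4.

Let qE y : q y = \sum_i z i y ^+ 2.
Proof.
rewrite /q /sqnorm (bigD1 ord0) //= [RHS](bigD1 ord0) //=.
rewrite [X in _ = _ + X](eq_bigr (fun i => y 0 i ^+ 2)); last first.
  by move=> i i0; rewrite /z (negbTE i0) mulr0 subr0.
by rewrite /z eqxx (_ : true%:R = 1 :> R) //; ring.
Qed.

Let q_ge y : U y -> (t - 1) ^+ 2 <= q y.
Proof.
move=> yU; rewrite qE (bigD1 ord0) //=.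
apply: ler_wpDr; first by apply: sumr_ge0 => i _; rewrite sqr_ge0.
have y1 : y 0 ord0 <= 1.
  apply: le_trans (ler_norm _) _; apply: le_trans (coord_le_enorm _ _) _.
  exact: ltW yU.
have t1' := t1; have -> : z ord0 y ^+ 2 = (t - y 0 ord0) ^+ 2.
  by rewrite /z eqxx mulr1; ring.
by rewrite !expr2; apply: ler_pM; lra.
Qed.

Let q_gt0 y : U y -> 0 < q y.
Proof. by move=> /q_ge; apply: lt_le_trans; rewrite exprn_gt0 // subr_gt0. Qed.

Let C1q y : C1_at q (fun i y => 2 * z i y) y.
Proof.
apply: C1_at_eq (C1_at_add (C1_at_add (C1_at_sqnorm y)
  (C1_at_mul (C1_at_cst (- (2 * t)) y) (C1_at_coord ord0 y))) (C1_at_cst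
    (t ^+ 2) y)).
  by move=> x; rewrite /q; ring.
by move=> i x; rewrite /z; ring.
Qed.

Let C1z i y : C1_at (z i) (fun k _ => (k == i)%:R) y.
Proof.
apply: C1_at_eq (C1_at_add (C1_at_coord i y) (C1_at_cst (- (t *
  (i == ord0)%:R)) y)).
  by move=> x.
by move=> k x; rewrite addr0.
Qed.

Let C1tau y : C1_at tau (fun i y => - (2 * y 0 i)) y.
Proof.
apply: C1_at_eq (C1_at_add (C1_at_cst (t ^+ 2) y) (C1_at_mul (C1_at_cst
  (-1) y) (C1_at_sqnorm y))).
  by move=> x; rewrite /tau; ring.
by move=> k x; ring.
Qed.

Let C1sg y : U y -> C1_at sg (fun i y => - z i y * sg y ^+ 3) y.
Proof.
move=> yU; have q0 := q_gt0 yU.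
have := C1_at_comp (C1q y) (inv_sqrt_derive q0)
  (dphi := fun v => - (1/2) * (Num.sqrt v)^-1 ^+ 3).
move=> H; apply: C1_at_ext (H _) => [i x|].
  by rewrite /sg; set s := (Num.sqrt _)^-1; field.
apply: continuousM; first exact: cst_continuous.
exact: (continuous_comp (inv_sqrt_cont q0) (@exprn_continuous R 3 _)).
Qed.

Let C1sgX m y : U y ->
  C1_at (fun y => sg y ^+ m.+1) (fun i y => - (m.+1)%:R * z i y * sg y ^+ m.+3) y.
Proof.
move=> yU; apply: C1_at_ext (C1_at_exp m.+1 (C1sg yU)) => i x /=.
by rewrite !exprS; ring.
Qed.

Lemma poisson_C1 y : U y -> C1_at u du y.
Proof.
move=> yU; apply: C1_at_ext (C1_at_mul (C1tau y) (C1sgX n'.+2 yU)) => i x.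
by rewrite /du; ring.
Qed.

Lemma poisson_C2 i y : U y -> C1_at (du i) (ddu i) y.
Proof.
move=> yU; apply: C1_at_eq (C1_at_add
  (C1_at_mul (C1_at_mul (C1_at_cst (-2) y) (C1_at_coord i y)) (C1sgX n'.+2 yU))
  (C1_at_mul (C1_at_mul (C1_at_mul (C1_at_cst (- n%:R) y) (C1tau y))
    (C1z i y)) (C1sgX n'.+4 yU))).
  by move=> x; rewrite /du; ring.
move=> k x; rewrite /ddu; ring.
Qed.

Lemma poisson_harmonic y : U y -> \sum_i ddu i i y = 0.
Proof.
move=> yU; have q0 := q_gt0 yU.
have sq : sg y ^+ 2 * q y = 1.
  by rewrite /sg exprVn sqr_sqrtr ?(ltW q0) // mulVf // gt_eqF.
have yz : \sum_i y 0 i * z i y = sqnorm y - t * y 0 ord0.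
  rewrite /z.
  under eq_bigr do rewrite mulrBr -expr2.
  rewrite sumrB; congr (_ - _).
  rewrite (bigD1 ord0) //= big1 => [|i i0]; first by rewrite mulr1 addr0 mulrC.
  by rewrite (negbTE i0) !mulr0.
have gen (a b d : R) : \sum_i (a + b * (y 0 i * z i y) + d * z i y ^+ 2) =
    a * n%:R + b * (sqnorm y - t * y 0 ord0) + d * q y.
  rewrite !big_split /= -!mulr_sumr yz -qE sumr_const card_ord.
  by rewrite -[_ *+ n]mulr_natr.
have -> : \sum_i ddu i i y =
  \sum_i ((- 2 * sg y ^+ n - n%:R * tau y * sg y ^+ n.+2)
   + (4 * n%:R * sg y ^+ n.+2) * (y 0 i * z i y)
   + (n%:R * (n.+2)%:R * tau y * sg y ^+ n.+4) * z i y ^+ 2).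
  by apply: eq_bigr => i _; rewrite /ddu eqxx (_ : true%:R = 1 :> R) //; ring.
rewrite gen.
transitivity (n%:R * sg y ^+ n * (-2 + (4 * (sqnorm y - t * y 0 ord0)
   - n%:R * tau y) * sg y ^+ 2
   + (n.+2)%:R * tau y * sg y ^+ 2 * (sg y ^+ 2 * q y))); first by rewrite
     !exprS; ring.
rewrite sq mulr1.
transitivity (n%:R * sg y ^+ n * (-2 * (sg y ^+ 2 * q y) + (4 *
  (sqnorm y - t * y 0 ord0)
   - n%:R * tau y) * sg y ^+ 2
   + (n.+2)%:R * tau y * sg y ^+ 2)); first by rewrite sq; ring.
by rewrite /q /tau; ring.
Qed.

Lemma poisson_bounds y : U y -> 0 < u y <= t ^+ 2 * (t - 1)^-1 ^+ n.
Proof.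
move=> yU; have q0 := q_gt0 yU; have t0 : 0 < t - 1 by rewrite subr_gt0.
have s0 : 0 < sg y by rewrite invr_gt0 sqrtr_gt0.
have sy : sqnorm y < 1 by rewrite -enorm_sq exprn_ilt1 // sqrtr_ge0.
have t2 : 1 < t ^+ 2 by rewrite exprn_egt1.
have tau0 : 0 < tau y by rewrite /tau; lra.
rewrite mulr_gt0 ?exprn_gt0 //=; apply: ler_pM; rewrite ?exprn_ge0 ?(ltW s0)
  ?(ltW tau0) //.
  by rewrite /tau; have := sqnorm_ge0 y; lra.
rewrite lerXn2r ?nnegrE ?(ltW s0) ?invr_ge0 ?(ltW t0) //.
rewrite lef_pV2 ?posrE ?sqrtr_gt0 // -[t - 1]gtr0_norm // -sqrtr_sqr.
by rewrite ler_wsqrtr // q_ge.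
Qed.

(** At the origin the logarithmic derivative of the kernel is n/t. *)
Lemma sharp_harmonic_t (c : R) :
  (forall h : 'rV[R]_n -> R, ball_to_pm1 h -> harmonic_on_ball h ->
       enorm (grad h 0) <= c * (1 - `|h 0| ^+ 2)) ->
  n%:R <= 2 * c * t.
Proof.
move=> Hc.
have := @sharp_from_positive R n 0 c _ u du ddu poisson_C1 poisson_C2 _ poisson_bounds _ ord0.
have t0 : 0 < t by exact: lt_trans t1.
have q0 : q 0 = t ^+ 2.
  by rewrite /q /sqnorm big1 ?mxE => [|i _]; rewrite ?mxE ?expr0n //; ring.
have sg0 : sg 0 = t^-1 by rewrite /sg q0 sqrtr_sqr ger0_norm // ltW.
have tau0 : tau 0 = t ^+ 2.
  by rewrite /tau /sqnorm big1 ?subr0 // => i _; rewrite mxE expr0n.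
have -> : du ord0 0 = n%:R * (t^-1 ^+ n * t).
  have tt : t * t^-1 = 1 by rewrite mulfV // gt_eqF.
  transitivity (n%:R * (t^-1 ^+ n * t) * (t * t^-1) ^+ 2); last first.
    by rewrite tt expr1n mulr1.
  by rewrite /du sg0 tau0 /z !mxE eqxx (_ : true%:R = 1 :> R) //; rewrite
    !exprS; ring.
have -> : 2 * c * u 0 = 2 * c * t * (t^-1 ^+ n * t).
  by rewrite /u sg0 tau0; ring.
rewrite ler_pM2r; last by rewrite mulr_gt0 // exprn_gt0 // invr_gt0.
apply=> [x xU|h hb /harmonic_eps hh]; last exact: Hc.
by rewrite poisson_harmonic // !mulr0 !mul0r addr0.
Qed.

End Poisson.

(** * Sharpness for hyperbolic harmonic functions: distance to a hyperplane *)
Section CosAtan.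
Context {R : realType}.

Definition cosatan (s : R) : R := (Num.sqrt (1 + s ^+ 2))^-1.

Let p0 (s : R) : 0 < 1 + s ^+ 2.
Proof. by rewrite ltr_wpDr ?sqr_ge0. Qed.

Lemma cosatan_gt0 s : 0 < cosatan s.
Proof. by rewrite invr_gt0 sqrtr_gt0. Qed.

Lemma cosatan_sq s : cosatan s ^+ 2 * (1 + s ^+ 2) = 1.
Proof. by rewrite exprVn sqr_sqrtr ?(ltW (p0 s)) // mulVf // gt_eqF. Qed.

Lemma cosatan_derive (s : R) : is_derive s 1 cosatan (- s * cosatan s ^+ 3).
Proof.
have D1 : is_derive s 1 (fun u : R => 1 + u ^+ 2) (2 * s).
  have DX : is_derive s 1 (fun u : R => u ^+ 2) (2 * s).
    apply: DeriveDef; first exact: exprn_derivable.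
    by rewrite -derive1E exp_derive1 expr1.
  by have := is_deriveD (is_derive_cst (1 : R) s 1) DX; rewrite add0r.
have D2 := inv_sqrt_derive (p0 s).
have D3 := @is_derive1_comp R (fun u => (Num.sqrt u)^-1) (fun u => 1 +
  u ^+ 2) s _ _ D2 D1.
apply: (is_derive_eq D3); rewrite /cosatan.
by set w := (Num.sqrt _)^-1; field.
Qed.

Lemma cosatanX_derive m (s : R) :
  is_derive s 1 (fun u => cosatan u ^+ m.+1) (- (m.+1)%:R * s * cosatan s ^+ m.+3).
Proof.
have D : is_derive (cosatan s) 1 (fun u : R => u ^+ m.+1)
  (m.+1%:R * cosatan s ^+ m).
  apply: DeriveDef; first exact: exprn_derivable.
  by rewrite -derive1E exp_derive1.
have D3 := @is_derive1_comp R (fun u => u ^+ m.+1) cosatan s _ _ D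
  (cosatan_derive s).
by apply: (is_derive_eq D3); rewrite !exprS; ring.
Qed.

Lemma cosatan_cont : continuous cosatan.
Proof. by move=> s; exact: is_derive_cont (cosatan_derive s). Qed.

Lemma cosatan_le1 s : cosatan s <= 1.
Proof.
have : Num.sqrt 1 <= Num.sqrt (1 + s ^+ 2) by rewrite ler_wsqrtr // lerDl sqr_ge0.
by rewrite sqrtr1 invf_le1 ?sqrtr_gt0.
Qed.

Lemma s_cosatan_le1 s : `|s * cosatan s| <= 1.
Proof.
rewrite normrM (ger0_norm (ltW (cosatan_gt0 s))) ler_pdivrMr ?sqrtr_gt0 // mul1r.
by rewrite -sqrtr_sqr ler_wsqrtr // lerDr.
Qed.

(** The reduction formula
    k cosatan^(k+2) = (s cosatan^k)' + (k - 1) cosatan^k starts from atan and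
    s cosatan, and preserves boundedness. *)
Lemma cosatan_primitive m : (2 <= m)%N -> exists (G : R -> R) (B : R),
  (forall s : R, is_derive s 1 G (cosatan s ^+ m)) /\ forall s, `|G s| <= B.
Proof.
have step k G B : (forall s : R, is_derive s 1 G (cosatan s ^+ k.+1)) ->
    (forall s, `|G s| <= B) -> exists (G : R -> R) (B : R),
  (forall s : R, is_derive s 1 G (cosatan s ^+ k.+3)) /\ forall s, `|G s| <= B.
  move=> DG HB.
  exists (fun s => (k.+1)%:R^-1 * (s * cosatan s ^+ k.+1 + k%:R * G s)).
  exists ((k.+1)%:R^-1 * (1 + k%:R * B)); split=> s.
    have D1 := is_deriveM (is_derive_id s (1 : R)) (cosatanX_derive k s).
    have D2 := is_deriveZ (k.+1)%:R^-1 (is_deriveD D1 (is_deriveZ k%:R (DG s))).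
    apply: (is_derive_eq D2).
    change ((k.+1)%:R^-1 * (s * (- (k.+1)%:R * s * cosatan s ^+ k.+3)
       + cosatan s ^+ k.+1 * 1 + k%:R * cosatan s ^+ k.+1) = cosatan s ^+ k.+3).
    have E : cosatan s ^+ k.+1 = cosatan s ^+ k.+3 * (1 + s ^+ 2).
      transitivity (cosatan s ^+ k.+1 * (cosatan s ^+ 2 * (1 + s ^+ 2))).
        by rewrite cosatan_sq mulr1.
      by rewrite !exprS; ring.
    rewrite E; have k0 : (k.+1)%:R != 0 :> R by rewrite pnatr_eq0.
    apply: (mulfI k0); by rewrite mulVKf // -!natr1; ring.
  rewrite normrM ger0_norm ?invr_ge0 // ler_wpM2l ?invr_ge0 //.
  apply: le_trans (ler_normD _ _) _; apply: lerD; last first.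
    by rewrite normrM ger0_norm // ler_wpM2l.
  rewrite exprS mulrA normrM -[leRHS]mulr1; apply: ler_pM => //;
    first exact: s_cosatan_le1.
  by rewrite ger0_norm ?exprn_ge0 ?(ltW (cosatan_gt0 s)) // exprn_ile1
    ?cosatan_le1 ?(ltW (cosatan_gt0 s)).
suff H k : exists (G : R -> R) (B : R),
   (forall s : R, is_derive s 1 G (cosatan s ^+ k.+2)) /\ forall s, `|G s| <= B.
  by case: m => [|[|m]] // _; exact: H.
elim/ltn_ind: k => -[|[|k]] IH.
- exists atan, pi; split=> s.
    apply: (is_derive_eq (is_derive1_atan s)).
    by rewrite /cosatan exprVn sqr_sqrtr // ltW // p0.
  have pp := pi_gt0 R.
  by rewrite ler_norml; have := atan_gtNpi2 s; have := atan_ltpi2 s; lra.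
- exists (fun s => s * cosatan s), 1; split=> s; last exact: s_cosatan_le1.
  have D1 := is_deriveM (is_derive_id s (1 : R)) (cosatan_derive s).
  apply: (is_derive_eq D1).
  change (s * (- s * cosatan s ^+ 3) + cosatan s * 1 = cosatan s ^+ 3).
  have E : cosatan s ^+ 3 * (1 + s ^+ 2) = cosatan s.
    by rewrite exprS -mulrA cosatan_sq mulr1.
  by rewrite mulr1 -[X in _ + X]E; ring.
have [G [B [DG HB]]] := IH k (ltnW (ltnSn _)).
exact: step DG HB.
Qed.

End CosAtan.

Section Hyperbolic.
Context {R : realType} {n' : nat}.
Notation n := n'.+3.
Variable S : R.
Hypothesis S0 : 0 < S.
Notation U := (@unit_ball R n).
Implicit Types x y : 'rV[R]_n.

Let C : R := Num.sqrt (1 + S ^+ 2).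

Let C0 : 0 < C.
Proof. by rewrite sqrtr_gt0 ltr_wpDr ?sqr_ge0. Qed.

Let C_sq : C ^+ 2 = 1 + S ^+ 2.
Proof. by rewrite sqr_sqrtr // addr_ge0 ?sqr_ge0. Qed.

(** In the hyperboloid model the signed distance rho to a geodesic hyperplane
    satisfies sinh rho = linear form; in the ball this linear form is
    [La] = (S (1 + |x|^2) - 2 C x_0)/(1 - |x|^2), with C^2 = 1 + S^2, and the
    hyperplane is at distance arsinh S of the origin.  A function G(La) is
    hyperbolic harmonic exactly when G' is proportional to (1 + s^2)^(-n/2),
    because |grad La|^2 = 1 + La^2 and Lap La = n La for the hyperbolic metric. *)
Let io y : R := (1 - sqnorm y)^-1.
Let om y : R := S - C * y 0 ord0.
Let La y : R := - S + 2 * om y * io y.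
Let dLa (i : 'I_n) y : R :=
  - 2 * C * (i == ord0)%:R * io y + 4 * om y * y 0 i * io y ^+ 2.
Let ddLa (i k : 'I_n) y : R :=
  - 4 * C * (i == ord0)%:R * y 0 k * io y ^+ 2
  - 4 * C * (k == ord0)%:R * y 0 i * io y ^+ 2
  + 4 * om y * (k == i)%:R * io y ^+ 2 + 16 * om y * y 0 i * y 0 k * io y ^+ 3.

Let w_gt0 y : U y -> 0 < 1 - sqnorm y.
Proof. by move=> yU; rewrite subr_gt0 -enorm_sq exprn_ilt1 // sqrtr_ge0. Qed.

Let C1io y : U y -> C1_at io (fun i y => 2 * y 0 i * io y ^+ 2) y.
Proof.
move=> /w_gt0 w0; have wn : 1 - sqnorm y != 0 by rewrite gt_eqF.
have A : C1_at (fun y => 1 - sqnorm y) (fun i y => - (2 * y 0 i)) y.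
  apply: C1_at_eq (C1_at_add (C1_at_cst 1 y) (C1_at_mul (C1_at_cst (-1) y)
    (C1_at_sqnorm y))).
    by move=> x; rewrite mulN1r.
  by move=> i x; ring.
have D : is_derive (1 - sqnorm y) 1 (fun s : R => s^-1) (- (1 - sqnorm y) ^- 2).
  have := @is_deriveV R id (1 - sqnorm y) 1 1 wn (is_derive_id _ (1 : R)).
  by move=> DV; apply: (is_derive_eq DV); exact: mulr1.
have H := @C1_at_comp R n (fun s => s^-1) (fun s => - s ^- 2) _ _ y A D.
apply: C1_at_ext (H _) => [i x|]; first by rewrite /io exprVn; ring.
apply: continuousN; apply: continuousV; first by rewrite expf_neq0.
exact: exprn_continuous.
Qed.

Let C1om y : C1_at om (fun i _ => - C * (i == ord0)%:R) y.
Proof.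
apply: C1_at_eq (C1_at_add (C1_at_cst S y)
  (C1_at_mul (C1_at_cst (- C) y) (C1_at_coord ord0 y))) => [x|i x].
  by rewrite /om mulNr.
by ring.
Qed.

Let C1La y : U y -> C1_at La dLa y.
Proof.
move=> yU; apply: C1_at_eq (C1_at_add (C1_at_cst (- S) y)
  (C1_at_mul (C1_at_mul (C1_at_cst 2 y) (C1om y)) (C1io yU))) => [x|i x] //.
by rewrite /dLa; ring.
Qed.

Let C1dLa i y : U y -> C1_at (dLa i) (ddLa i) y.
Proof.
move=> yU; apply: C1_at_eq (C1_at_add
   (C1_at_mul (C1_at_cst (- 2 * C * (i == ord0)%:R) y) (C1io yU))
   (C1_at_mul (C1_at_mul (C1_at_mul (C1_at_cst 4 y) (C1om y)) (C1_at_coord i y))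
      (C1_at_mul (C1io yU) (C1io yU)))) => [x|k x].
  by rewrite /dLa expr2.
by rewrite /ddLa; ring.
Qed.

Let sum_e0 (f : 'I_n -> R) : \sum_i (i == ord0)%:R * f i = f ord0.
Proof.
rewrite (bigD1 ord0) //= mul1r big1 ?addr0 // => i i0.
by rewrite (negbTE i0) mul0r.
Qed.

Let bool_sq (b : bool) : (b%:R : R) ^+ 2 = b%:R.
Proof. by case: b; rewrite ?expr1n ?expr0n. Qed.

Let io_w y : U y -> io y * (1 - sqnorm y) = 1.
Proof. by move=> /w_gt0 w0; rewrite mulVf // gt_eqF. Qed.

(** The hyperbolic gradient of [La] has squared norm 1 + La^2. *)
Let sum_dLa2 y : U y -> (1 - sqnorm y) * \sum_i dLa i y ^+ 2 = 4 * (1 +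
  La y ^+ 2) * io y.
Proof.
move=> yU.
have -> : \sum_i dLa i y ^+ 2 = 4 * C ^+ 2 * io y ^+ 2
   - 16 * C * om y * y 0 ord0 * io y ^+ 3 + 16 * om y ^+ 2 * sqnorm y * io y ^+ 4.
  rewrite -[_ * io y ^+ 2](sum_e0 (fun=> 4 * C ^+ 2 * io y ^+ 2)).
  rewrite -[16 * C * _ * _ * _](sum_e0 (fun i =>
    16 * C * om y * y 0 i * io y ^+ 3)).
  rewrite /sqnorm !mulr_sumr !mulr_suml -sumrB -big_split /=; apply: eq_bigr => i _.
  by rewrite -{1}bool_sq /dLa; ring.
have W := io_w yU.
have sE : sqnorm y * io y = io y - 1 by rewrite -[X in _ - X]W; ring.
have omE : C * y 0 ord0 = S - om y by rewrite /om; ring.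
transitivity (io y * (io y * (1 - sqnorm y)) * (4 * C ^+ 2
   - 16 * om y * (C * y 0 ord0) * io y + 16 * om y ^+ 2 * io y *
     (sqnorm y * io y))).
  by ring.
by rewrite W sE omE C_sq /La; ring.
Qed.

(** [La] is an eigenfunction of the hyperbolic Laplacian, with eigenvalue n. *)
Let sum_ddLa y : U y -> (1 - sqnorm y) * \sum_i ddLa i i y
  + 2 * (n%:R - 2) * \sum_i y 0 i * dLa i y = 4 * n%:R * La y * io y.
Proof.
move=> yU.
have -> : \sum_i ddLa i i y = - 8 * C * y 0 ord0 * io y ^+ 2
   + 4 * n%:R * om y * io y ^+ 2 + 16 * om y * sqnorm y * io y ^+ 3.
  rewrite -[- 8 * C * _ * _](sum_e0 (fun i => - 8 * C * y 0 i * io y ^+ 2)).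
  have -> : 4 * n%:R * om y * io y ^+ 2 = \sum_(i < n) (4 * om y * io y ^+ 2).
    by rewrite sumr_const card_ord -[RHS]mulr_natr; ring.
  rewrite /sqnorm !mulr_sumr !mulr_suml -!big_split /=; apply: eq_bigr => i _.
  by rewrite /ddLa eqxx (_ : true%:R = 1 :> R) //; ring.
have -> : \sum_i y 0 i * dLa i y = - 2 * C * y 0 ord0 * io y
   + 4 * om y * sqnorm y * io y ^+ 2.
  rewrite -[- 2 * C * _ * _](sum_e0 (fun i => - 2 * C * y 0 i * io y)).
  rewrite /sqnorm !mulr_sumr !mulr_suml -!big_split /=; apply: eq_bigr => i _.
  by rewrite /dLa; ring.
have W := io_w yU.
have sE : sqnorm y * io y = io y - 1 by rewrite -[X in _ - X]W; ring.
have omE : C * y 0 ord0 = S - om y by rewrite /om; ring.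
transitivity (io y * (io y * (1 - sqnorm y)) * (- 8 * (C * y 0 ord0)
   + 4 * n%:R * om y + 16 * om y * (sqnorm y * io y))
  + 2 * (n%:R - 2) * io y * (- 2 * (C * y 0 ord0) + 4 * om y * (sqnorm y * io y))).
  by ring.
by rewrite W sE omE /La; ring.
Qed.

Variables (G : R -> R) (B : R).
Hypothesis DG : forall s : R, is_derive s 1 G (cosatan s ^+ n).
Hypothesis HB : forall s, `|G s| <= B.

Let p : R := (n'.+2)%:R.
(** An upper bound of [G] that is nearly optimal: the integral of
    (1 + s^2)^(-n/2) over [S, +oo) is at most that of s^(-n). *)
Let A : R := G S + p^-1 * S^-1 ^+ n'.+2.

Let p_gt0 : 0 < p. Proof. by rewrite /p. Qed.

Let cosatan_lt (s : R) : 0 < s -> cosatan s <= s^-1.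
Proof.
move=> s0; rewrite lef_pV2 ?posrE ?sqrtr_gt0 // ?ltr_wpDr ?sqr_ge0 //.
by rewrite -{1}(ger0_norm (ltW s0)) -sqrtr_sqr ler_wsqrtr // lerDr.
Qed.

(** Beyond [S], the derivative of [Psi] is (1 + t^2)^(-n/2) - t^(-n) <= 0. *)
Let G_lt_A (s : R) : G s < A.
Proof.
have SV : 0 < p^-1 * S^-1 ^+ n'.+2 by rewrite mulr_gt0 ?exprn_gt0 ?invr_gt0.
case: (leP s S) => sS.
  apply: (@le_lt_trans _ _ (G S)); last by rewrite /A ltrDl.
  have [|u _ E] := @MVT_segment R G (fun s => cosatan s ^+ n) s S sS
    (fun u _ => DG u).
    apply: (@continuous_in_subspaceT R R `[s, S] G) => u _.
    exact: is_derive_cont (DG u).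
  by rewrite -subr_ge0 E mulr_ge0 ?subr_ge0 // exprn_ge0 // ltW // cosatan_gt0.
pose Psi (t : R) := G t + p^-1 * t^-1 ^+ n'.+2.
have D (t : R) : S <= t -> is_derive t 1 Psi (cosatan t ^+ n - t^-1 ^+ n).
  move=> St; have t0 : 0 < t := lt_le_trans S0 St.
  have tn : t != 0 by rewrite gt_eqF.
  have DV : is_derive t 1 (fun s : R => s^-1) (- t ^- 2).
    have := @is_deriveV R id t 1 1 tn (is_derive_id _ (1 : R)).
    by move=> DV; apply: (is_derive_eq DV); exact: mulr1.
  have DE : is_derive t^-1 1 (fun s : R => s ^+ n'.+2) (p * t^-1 ^+ n'.+1).
    apply: DeriveDef; first exact: exprn_derivable.
    by rewrite -derive1E exp_derive1.
  have DC := @is_derive1_comp R (fun s => s ^+ n'.+2) (fun s => s^-1) t _ _ DE DV.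
  have DS := is_deriveD (DG t) (is_deriveZ p^-1 DC).
  apply: (is_derive_eq DS); congr (_ + _).
  change (p^-1 * (p * t^-1 ^+ n'.+1 * - t ^- 2) = - t^-1 ^+ n).
  rewrite -mulrA mulKf ?gt_eqF // mulrN -exprVn; congr (- _).
  by rewrite !exprS; ring.
have [|| u uin E] := @MVT_segment R Psi (fun t =>
  cosatan t ^+ n - t^-1 ^+ n) S s (ltW sS).
- by move=> u; rewrite in_itv /= => /andP[Su _]; apply: D; exact: ltW.
- apply: (@continuous_in_subspaceT R R `[S, s] Psi) => u /set_mem /=.
  rewrite in_itv /= => /andP[Su _]; exact: is_derive_cont (D u Su).
have s0 : 0 < s := lt_trans S0 sS.
have : Psi s <= Psi S.
  rewrite -subr_le0 E; apply: mulr_le0_ge0; last by rewrite subr_ge0 ltW.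
  move: uin; rewrite in_itv /= => /andP[Su _].
  have u0 : 0 < u := lt_le_trans S0 Su.
  rewrite subr_le0 lerXn2r ?nnegrE ?invr_ge0 ?(ltW u0) ?(ltW (cosatan_gt0 u)) //.
  exact: cosatan_lt.
have : 0 < p^-1 * s^-1 ^+ n'.+2 by rewrite mulr_gt0 ?exprn_gt0 ?invr_gt0.
by rewrite /Psi /A => h1 h2; apply: lt_le_trans h2; rewrite ltrDl.
Qed.

Let u y := A - G (La y).
Let du i y := - cosatan (La y) ^+ n * dLa i y.
Let ddu i k y := n%:R * La y * cosatan (La y) ^+ n.+2 * dLa k y * dLa i y
  - cosatan (La y) ^+ n * ddLa i k y.

Let C1cosatan y : U y -> C1_at (fun y => cosatan (La y) ^+ n)
  (fun k y => - n%:R * La y * cosatan (La y) ^+ n.+2 * dLa k y) y.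
Proof.
move=> yU; apply: (@C1_at_comp R n (fun s => cosatan s ^+ n)
  (fun s => - n%:R * s * cosatan s ^+ n.+2) _ _ _ (C1La yU) (cosatanX_derive _ _)).
apply: continuousM.
  by apply: continuousM; [exact: cst_continuous|exact: cvg_id].
exact: (continuous_comp (cosatan_cont (x := _)) (@exprn_continuous R n.+2 _)).
Qed.

Let hyp_C1 y : U y -> C1_at u du y.
Proof.
move=> yU; have C1G := @C1_at_comp R n G (fun s => cosatan s ^+ n) _ _ _
  (C1La yU) (DG _).
have H : {for La y, continuous (fun s : R => cosatan s ^+ n)}.
  exact: (continuous_comp (cosatan_cont (x := _)) (@exprn_continuous R n _)).
apply: C1_at_eq (C1_at_add (C1_at_cst A y) (C1_at_mul (C1_at_cst (-1) y)
  (C1G H))) => [x|i x].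
  by rewrite /u mulN1r.
by rewrite /du; ring.
Qed.

Let hyp_C2 i y : U y -> C1_at (du i) (ddu i) y.
Proof.
move=> yU; apply: C1_at_eq (C1_at_mul (C1_at_mul (C1_at_cst (-1) y) (C1cosatan yU))
   (C1dLa i yU)) => [x|k x].
  by rewrite /du mulN1r.
by rewrite /ddu; ring.
Qed.

Let hyp_PDE y : U y -> (1 - 1 * sqnorm y) * \sum_i ddu i i y
    + 2 * 1 * (n%:R - 2) * \sum_i y 0 i * du i y = 0.
Proof.
move=> yU; rewrite mul1r mulr1.
have -> : \sum_i ddu i i y = n%:R * La y * cosatan
  (La y) ^+ n.+2 * \sum_i dLa i y ^+ 2
    - cosatan (La y) ^+ n * \sum_i ddLa i i y.
  by rewrite !mulr_sumr -sumrB; apply: eq_bigr => i _; rewrite /ddu; ring.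
have -> : \sum_i y 0 i * du i y = - cosatan (La y) ^+ n * \sum_i y 0 i * dLa i y.
  by rewrite mulr_sumr; apply: eq_bigr => i _; rewrite /du; ring.
have E1 := sum_dLa2 yU; have E2 := sum_ddLa yU; have E3 := cosatan_sq (La y).
transitivity (n%:R * La y * cosatan (La y) ^+ n.+2 *
    ((1 - sqnorm y) * \sum_i dLa i y ^+ 2)
  - cosatan (La y) ^+ n * ((1 - sqnorm y) * \sum_i ddLa i i y
  + 2 * (n%:R - 2) * \sum_i y 0 i * dLa i y)); first by ring.
rewrite E1 E2.
transitivity (4 * n%:R * La y * io y * cosatan (La y) ^+ n *
   (cosatan (La y) ^+ 2 * (1 + La y ^+ 2) - 1)); first by rewrite !exprS; ring.
by rewrite E3 subrr mulr0.
Qed.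

(** Here u(0) = A - G(S) = S^(1-n)/(n - 1), and d_0 u(0) = 2 C^(1-n). *)
Lemma sharp_hyperbolic_S (c : R) :
  (forall h : 'rV[R]_n -> R, ball_to_pm1 h -> hyp_harmonic_on_ball h ->
       enorm (grad h 0) <= c * (1 - `|h 0| ^+ 2)) ->
  p * (S / C) ^+ n'.+2 <= c.
Proof.
move=> Hc.
have bd y : U y -> 0 < u y <= A + B.
  move=> _; rewrite /u subr_gt0 G_lt_A /=.
  by have := HB (La y); rewrite ler_norml => /andP[h1 _]; lra.
have := @sharp_from_positive R n 1 c _ u du ddu hyp_C1 hyp_C2 hyp_PDE bd _ ord0.
have io0 : io 0 = 1.
  by rewrite /io /sqnorm big1 ?subr0 ?invr1 // => i _; rewrite mxE expr0n.
have om0 : om 0 = S by rewrite /om mxE mulr0 subr0.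
have La0 : La 0 = S by rewrite /La io0 om0; ring.
have -> : du ord0 0 = 2 * C^-1 ^+ n'.+2.
  rewrite /du La0 /dLa io0 om0 !mxE eqxx (_ : true%:R = 1 :> R) // -/(C^-1).
  have -> : cosatan S = C^-1 by [].
  transitivity (2 * C^-1 ^+ n'.+2 * (C^-1 * C)); first by rewrite !exprS; ring.
  by rewrite mulVf ?mulr1 // gt_eqF.
have -> : u 0 = p^-1 * S^-1 ^+ n'.+2 by rewrite /u La0 /A addrAC subrr add0r.
have H1 : forall h : 'rV[R]_n -> R, ball_to_pm1 h -> eps_harmonic 1 h ->
     enorm (grad h 0) <= c * (1 - `|h 0| ^+ 2).
  by move=> h hb hh; apply: Hc => //; apply/hyp_harmonic_eps.
move=> /(_ H1) H2.
have q0 : 0 < p * S ^+ n'.+2 by rewrite mulr_gt0 // exprn_gt0.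
have := H2; rewrite -(ler_pM2l q0).
have -> : p * S ^+ n'.+2 * (2 * c * (p^-1 * S^-1 ^+ n'.+2)) =
    2 * c * (p * p^-1) * (S ^+ n'.+2 * S^-1 ^+ n'.+2) by ring.
rewrite mulfV ?gt_eqF // mulr1 -exprMn mulfV ?gt_eqF // expr1n mulr1.
rewrite exprMn; lra.
Qed.

End Hyperbolic.

(** * The estimate and its sharpness *)
Section Main.
Context {R : realType} {n : nat}.
Hypothesis n3 : (3 <= n)%N.

(** [direction_bound] in the direction of the gradient, or in any direction if the
    gradient vanishes. *)
Lemma gradient_bound (eps : R) (h : 'rV[R]_n -> R) : 0 <= eps -> eps <= 1 ->
  ball_to_pm1 h -> eps_harmonic eps h ->
  exists2 d : R, 0 < d & enorm (grad h 0) <=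
    (n%:R + eps * (n%:R - 2)) / 2 * (1 - `|h 0| ^+ 2) - (n%:R - 3) * d.
Proof.
move=> eps0 eps1 hb [hC hE].
have n3r : 3 <= n%:R :> R by rewrite ler_nat.
have n0r : 0 < n%:R :> R by lra.
have m0 : 0 < n%:R + eps * (n%:R - 2).
  by rewrite ltr_wpDr // mulr_ge0 //; lra.
have a1 x : enorm x < 1 -> `|h x| < 1 by move=> /hb; rewrite ltr_norml.
have h01 : `|h 0| < 1 by apply: a1; exact: zero_in_ball.
have aE : `|h 0| ^+ 2 = h 0 ^+ 2 by rewrite real_normK ?num_real.
have d0 : 0 < cap_slope (- h 0) / n%:R by rewrite divr_gt0 // cap_slope_gt0 //
  normrN.
exists ((n%:R + eps * (n%:R - 2)) * (cap_slope (- h 0) / n%:R));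
  first by rewrite mulr_gt0.
have -> : (n%:R + eps * (n%:R - 2)) / 2 * (1 - `|h 0| ^+ 2)
    - (n%:R - 3) * ((n%:R + eps * (n%:R - 2)) * (cap_slope (- h 0) / n%:R))
  = (n%:R + eps * (n%:R - 2)) * ((1 - h 0 ^+ 2) / 2
     - (n%:R - 3) * (cap_slope (- h 0) / n%:R)).
  by rewrite aE; ring.
have [L HL] := @sphere_mean_exists R n (ltnW n3).
have H0 x (xU : enorm x < 1) := (class_C2_C1_at hC xU).1.
have H1 i x (xU : enorm x < 1) := (class_C2_C1_at hC xU).2 i.
have bound e (e1 : enorm e = 1) := direction_bound n3 HL H0 H1 eps0 eps1 hE e1 a1.
set g := grad h 0.
have g0 : 0 <= enorm g by exact: sqrtr_ge0.
have [gz|gz] := eqVneq (enorm g) 0.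
  pose i0 := Ordinal (leq_trans (isT : (0 < 3)%N) n3).
  pose e : 'rV[R]_n := delta_mx 0 i0.
  have e1 : enorm e = 1.
    rewrite /enorm (bigD1 i0) //= big1 => [|i ii0].
      by rewrite !mxE !eqxx addr0 expr1n sqrtr1.
    by rewrite !mxE eqxx (negbTE ii0) expr0n.
  have kz : \sum_i e 0 i * partial i h 0 = 0.
    apply: big1 => i _; have := coord_le_enorm g i.
    by rewrite gz normr_le0 mxE => /eqP ->; rewrite mulr0.
  by have := bound e e1; rewrite kz gz; apply.
pose e := (enorm g)^-1 *: g.
have e1 : enorm e = 1 by rewrite /e enormZ ger0_norm ?invr_ge0 // mulVf.
have kE : \sum_i e 0 i * partial i h 0 = enorm g.
  transitivity ((enorm g)^-1 * sqnorm g).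
    by rewrite /sqnorm mulr_sumr; apply: eq_bigr => i _; rewrite !mxE expr2 mulrA.
  by rewrite -enorm_sq expr2 mulKf.
by have := bound e e1; rewrite kE; apply.
Qed.

Lemma sharp_harmonic (c : R) :
  (forall h : 'rV[R]_n -> R, ball_to_pm1 h -> harmonic_on_ball h ->
       enorm (grad h 0) <= c * (1 - `|h 0| ^+ 2)) ->
  n%:R / 2 <= c.
Proof.
case: n n3 => [|[|[|m]]] // _ Hc.
have H t : 1 < t -> (m.+3)%:R <= 2 * c * t := fun t1 => sharp_harmonic_t t1 Hc.
have n0 : 0 < (m.+3)%:R :> R by [].
have c0 : 0 < c.
  have /H : 1 < 2 :> R by rewrite ltr1n.
  by lra.
rewrite leNgt; apply/negP => cn.
have /H : 1 < (1 + (m.+3)%:R / (2 * c)) / 2.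
  have : 1 < (m.+3)%:R / (2 * c) by rewrite ltr_pdivlMr; lra.
  by lra.
have -> : 2 * c * ((1 + (m.+3)%:R / (2 * c)) / 2) = c + (m.+3)%:R / 2.
  by field; rewrite gt_eqF.
by lra.
Qed.

Lemma bernoulli_le (d : R) k : 0 <= d -> d <= 1 -> 1 - k%:R * d <= (1 - d) ^+ k.
Proof.
move=> d0 d1; elim: k => [|k IH]; first by rewrite mul0r subr0.
rewrite exprS; apply: (@le_trans _ _ ((1 - d) * (1 - k%:R * d))); last first.
  by rewrite ler_wpM2l // subr_ge0.
rewrite -natr1; have : 0 <= k%:R * d * d by rewrite !mulr_ge0.
by lra.
Qed.

Lemma sharp_hyperbolic (c : R) :
  (forall h : 'rV[R]_n -> R, ball_to_pm1 h -> hyp_harmonic_on_ball h ->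
       enorm (grad h 0) <= c * (1 - `|h 0| ^+ 2)) ->
  n%:R - 1 <= c.
Proof.
case: n n3 => [|[|[|m]]] // _ Hc.
have [G [B [DG HB]]] := @cosatan_primitive R m.+3 isT.
rewrite -natr1 addrK; set p : R := (m.+2)%:R.
have p0 : 0 < p by [].
rewrite leNgt; apply/negP => cp.
have pc : 0 < p - c by rewrite subr_gt0.
(* large enough for p (1 - p / (S + 1)) to exceed c *)
pose S := p ^+ 2 / (p - c).
have S0 : 0 < S by rewrite divr_gt0 // exprn_gt0.
have := sharp_hyperbolic_S S0 DG HB Hc.
set C := Num.sqrt _.
have C0 : 0 < C by rewrite sqrtr_gt0 ltr_wpDr ?sqr_ge0.
have CS : C <= S + 1.
  have s1 : 0 <= S + 1 by lra.
  rewrite -[leRHS]ger0_norm // -sqrtr_sqr ler_wsqrtr //.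
  by rewrite sqrrD expr1n mulr1; lra.
have q1 : (S + 1)^-1 <= 1 by rewrite invf_le1; lra.
have q0 : 0 < (S + 1)^-1 by rewrite invr_gt0; lra.
have SC : 1 - (S + 1)^-1 <= S / C.
  have -> : 1 - (S + 1)^-1 = S / (S + 1) by field; rewrite gt_eqF //; lra.
  by rewrite ler_wpM2l ?(ltW S0) // lef_pV2 // posrE; lra.
have low : 1 - p * (S + 1)^-1 <= (S / C) ^+ m.+2.
  apply: le_trans (bernoulli_le m.+2 (ltW q0) q1) _.
  by rewrite lerXn2r ?nnegrE ?subr_ge0 // divr_ge0 // ltW.
have up : p * (p * (S + 1)^-1) < p - c.
  rewrite mulrA -expr2 ltr_pdivrMr; last by lra.
  have -> : (p - c) * (S + 1) = p ^+ 2 + (p - c).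
    by rewrite mulrDr mulr1 mulrC divfK // gt_eqF.
  by rewrite ltrDl.
move=> main.
have : p * (1 - p * (S + 1)^-1) <= c.
  by apply: le_trans main; rewrite ler_wpM2l // ltW.
by lra.
Qed.

End Main.

Local Close Scope classical_set_scope.

Theorem corollary2 (R : realType) (n : nat) (hn : (3 <= n)%N) :
  (forall h : 'rV[R]_n -> R, ball_to_pm1 h ->
    (harmonic_on_ball h ->
       enorm (grad h 0) <= n%:R / 2 * (1 - `|h 0| ^+ 2)) /\
    (hyp_harmonic_on_ball h ->
       enorm (grad h 0) <= (n%:R - 1) * (1 - `|h 0| ^+ 2)))
  /\
  (forall c : R,
    (forall h : 'rV[R]_n -> R, ball_to_pm1 h -> harmonic_on_ball h ->
       enorm (grad h 0) <= c * (1 - `|h 0| ^+ 2)) ->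
    n%:R / 2 <= c)
  /\
  (forall c : R,
    (forall h : 'rV[R]_n -> R, ball_to_pm1 h -> hyp_harmonic_on_ball h ->
       enorm (grad h 0) <= c * (1 - `|h 0| ^+ 2)) ->
    n%:R - 1 <= c)
  /\
  ((4 <= n)%N -> forall h : 'rV[R]_n -> R, ball_to_pm1 h ->
    (harmonic_on_ball h ->
       enorm (grad h 0) < n%:R / 2 * (1 - `|h 0| ^+ 2)) /\
    (hyp_harmonic_on_ball h ->
       enorm (grad h 0) < (n%:R - 1) * (1 - `|h 0| ^+ 2))).
Proof.
have n3 : 3 <= n%:R :> R by rewrite ler_nat.
have harm : n%:R / 2 = (n%:R + 0 * (n%:R - 2)) / 2 :> R by rewrite mul0r addr0.
have hyp : n%:R - 1 = (n%:R + 1 * (n%:R - 2)) / 2 :> R by field.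
split; last split; last split.
- move=> h hb; split=> [/harmonic_eps hh|/hyp_harmonic_eps hh].
    have [d d0] := gradient_bound hn (lexx 0) ler01 hb hh.
    move=> /le_trans; apply; rewrite harm gerBl mulr_ge0 ?(ltW d0) //; lra.
  have [d d0] := gradient_bound hn ler01 (lexx 1) hb hh.
  move=> /le_trans; apply; rewrite hyp gerBl mulr_ge0 ?(ltW d0) //; lra.
- exact: sharp_harmonic.
- exact: sharp_hyperbolic.
- move=> n4 h hb; have n4r : 4 <= n%:R :> R by rewrite ler_nat.
  split=> [/harmonic_eps hh|/hyp_harmonic_eps hh].
    have [d d0] := gradient_bound hn (lexx 0) ler01 hb hh.
    move=> /le_lt_trans; apply; rewrite harm gtrBl mulr_gt0 //; lra.
  have [d d0] := gradient_bound hn ler01 (lexx 1) hb hh.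
  move=> /le_lt_trans; apply; rewrite hyp gtrBl mulr_gt0 //; lra.
Qed.
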